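(* Let $p$ be an odd prime, let $n\ge 4$ be an even integer, and let $f:\mathbb{F}_p^n\to\mathbb{F}_p$ be a non-weakly regular bent function belonging to $\mathcal{DBF}$ such that $B_+(f)$ and $B_+(f^* )$ are both non-degenerate $r$-dimensional subspaces over $\mathbb{F}_p$. If $\frac n2+1\le r\le n-1$, then $$U_4=\Big\{\{0\},\ B_+(f)^\bot\setminus\{0\},\ c_0(f)\setminus B_+(f)^\bot,\ \bigcup_{i\in SQ}c_i(f),\ \bigcup_{i\in NSQ}c_i(f),\ d_0(f),\ \bigcup_{i\in SQ}d_i(f),\ \bigcup_{i\in NSQ}d_i(f)\Big\}$$ is a partition of $\mathbb{F}_p^n$ and induces a $7$-class symmetric association scheme, and $$U_5=\Big\{\{0\},\ B_+(f)^\bot\setminus\{0\},\ c_0(f)\setminus B_+(f)^\bot,\ \bigcup_{i\in\mathbb{F}_p^*}c_i(f),\ d_0(f),\ \bigcup_{i\in\mathbb{F}_p^*}d_i(f)\Big\}$$ is a partition of $\mathbb{F}_p^n$ and induces a $5$-class symmetric association scheme.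
   Context: Let $p$ be an odd prime, $n$ a positive integer, $x\cdot y$ the ordinary inner product on $\mathbb{F}_p^n$, and $\xi_p=e^{2\pi\sqrt{-1}/p}$. $SQ$ and $NSQ$ denote the sets of squares and of nonsquares in $\mathbb{F}_p^*$. Bent functions. For $f:\mathbb{F}_p^n\to\mathbb{F}_p$ the Walsh transform is $\mathcal{W}_f(\alpha)=\sum_{x\in\mathbb{F}_p^n}\xi_p^{f(x)-\alpha\cdot x}$, $\alpha\in\mathbb{F}_p^n$; $f$ is bent if $|\mathcal{W}_f(\alpha)|=p^{n/2}$ for all $\alpha$. Put $\mu=1$ if $p^n\equiv1\pmod 4$ and $\mu=\sqrt{-1}$ if $p^n\equiv3\pmod4$. For a bent $f$ it is known that for every $\alpha$, $\mathcal{W}_f(\alpha)\in\{\mu p^{n/2}\xi_p^{f^*(\alpha)},-\mu p^{n/2}\xi_p^{f^*(\alpha)}\}$ for a (unique) function $f^*:\mathbb{F}_p^n\to\mathbb{F}_p$, called the dual of $f$. A bent $f$ is weakly regular if there is $\lambda\in\{\pm1,\pm\sqrt{-1}\}$ independent of $\alpha$ with $\mathcal{W}_f(\alpha)=\lambda p^{n/2}\xi_p^{f^*(\alpha)}$ for all $\alpha$; otherwise it is non-weakly regular. A bent $f$ is dual-bent if $f^*$ is also bent. For a bent function $f$: $B_+(f)=\{\alpha:\mathcal{W}_f(\alpha)=\mu p^{n/2}\xi_p^{f^*(\alpha)}\}$ and $B_-(f)=\{\alpha:\mathcal{W}_f(\alpha)=-\mu p^{n/2}\xi_p^{f^*(\alpha)}\}$.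 For $f$ dual-bent, $B_\pm(f^* )$ are defined by the same formulas applied to the bent function $f^*$. For dual-bent $f$ and $j\in\mathbb{F}_p$: $c_j(f)=\{x\in B_+(f^* ):f(x)=j\}$, $d_j(f)=\{x\in B_-(f^* ):f(x)=j\}$. $\mathcal{DBF}$ is the set of dual-bent functions $f:\mathbb{F}_p^n\to\mathbb{F}_p$ such that $f(0)=0$ and there is a positive integer $h$ with $\gcd(h-1,p-1)=1$ and $f(ax)=a^hf(x)$ for all $a\in\mathbb{F}_p^*$, $x\in\mathbb{F}_p^n$. For a subspace $V$ of $\mathbb{F}_p^n$, $V^\bot$ is its orthogonal complement with respect to $\cdot$; $V$ is non-degenerate if $\{x\in V:x\cdot y=0\ \text{for all } y\in V\}=\{0\}$. Association schemes. A $d$-class association scheme on a nonempty finite set $X$ is a partition of $X\times X$ into relations $R_0,\dots,R_d$ such that $R_0=\{(x,x):x\in X\}$; for each $j$ the transpose $R_j^T$ equals some $R_{j'}$; and for all $u,v,w$ and $(x,y)\in R_w$ the number $|\{z\in X:(x,z)\in R_u,(z,y)\in R_v\}|$ depends only on $u,v,w$. It is symmetric if $R_j^T=R_j$ for all $j$. A partition $\{U_i\}_{i=0}^d$ of $\mathbb{F}_p^n$ (into nonempty sets) with $U_0=\{0\}$ induces a $d$-class symmetric association scheme if the relations $R_i=\{(\alpha,\beta):\alpha-\beta\in U_i\}$, $0\le i\le d$, form a symmetric association scheme on $\mathbb{F}_p^n$. *)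

(* Defs.v *)
From HB Require Import structures.
From mathcomp Require Import all_boot all_order all_algebra all_field.

Set Implicit Arguments.
Unset Strict Implicit.
Unset Printing Implicit Defensive.

Import Order.TTheory GRing.Theory Num.Theory.

Local Open Scope ring_scope.

Definition dot (p n : nat) (x y : 'rV['F_p]_n) : 'F_p :=
  \sum_(i < n) x 0 i * y 0 i.

(* In algC, [p.-root z] is the p-th root of z of minimal nonnegative argument,
   so [p.-root (-1)] is exp(i pi / p) and its square is exp(2 i pi / p). *)
Definition xi (p : nat) : algC := (p.-root (-1)) ^+ 2.

(* p^(n/2), also for odd n *)
Definition sqrt_pn (p n : nat) : algC := sqrtC (p%:R) ^+ n.

(* For p odd, p ^ n is 1 or 3 modulo 4. *)
Definition mu (p n : nat) : algC := if (p ^ n %% 4 == 1)%N then 1 else 'i.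

Definition walsh (p n : nat) (f : 'rV['F_p]_n -> 'F_p) (a : 'rV['F_p]_n) :
    algC :=
  \sum_(x : 'rV['F_p]_n) xi p ^+ (f x - dot a x)%R.

Definition bent (p n : nat) (f : 'rV['F_p]_n -> 'F_p) : Prop :=
  forall a : 'rV['F_p]_n, `|walsh f a| = sqrt_pn p n.

(* For f bent and p an odd prime, exactly one c satisfies the condition, for
   every a, so that the default value 0 of [odflt] plays no role. *)
Definition dual (p n : nat) (f : 'rV['F_p]_n -> 'F_p) (a : 'rV['F_p]_n) :
    'F_p :=
  odflt 0 [pick c : 'F_p
          | (walsh f a == mu p n * sqrt_pn p n * xi p ^+ c)
         || (walsh f a == - (mu p n * sqrt_pn p n * xi p ^+ c))].

Definition weakly_regular (p n : nat) (f : 'rV['F_p]_n -> 'F_p) : Prop :=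
  bent f /\
  exists2 l : algC, l \in [:: 1; -1; 'i; - 'i]
    & forall a : 'rV['F_p]_n,
        walsh f a = l * sqrt_pn p n * xi p ^+ dual f a.

Definition non_weakly_regular (p n : nat) (f : 'rV['F_p]_n -> 'F_p) : Prop :=
  bent f /\ ~ weakly_regular f.

Definition dual_bent (p n : nat) (f : 'rV['F_p]_n -> 'F_p) : Prop :=
  bent f /\ bent (dual f).

Definition Bplus (p n : nat) (f : 'rV['F_p]_n -> 'F_p) : {set 'rV['F_p]_n} :=
  [set a | walsh f a == mu p n * sqrt_pn p n * xi p ^+ dual f a].

Definition Bminus (p n : nat) (f : 'rV['F_p]_n -> 'F_p) : {set 'rV['F_p]_n} :=
  [set a | walsh f a == - (mu p n * sqrt_pn p n * xi p ^+ dual f a)].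

Definition cset (p n : nat) (f : 'rV['F_p]_n -> 'F_p) (j : 'F_p) :
    {set 'rV['F_p]_n} :=
  [set x in Bplus (dual f) | f x == j].

Definition dset (p n : nat) (f : 'rV['F_p]_n -> 'F_p) (j : 'F_p) :
    {set 'rV['F_p]_n} :=
  [set x in Bminus (dual f) | f x == j].

Definition DBF (p n : nat) (f : 'rV['F_p]_n -> 'F_p) : Prop :=
  [/\ dual_bent f,
      f 0 = 0
    & exists h : nat,
        [/\ (0 < h)%N,
            gcdn (h - 1) (p - 1) = 1%N
          & forall (a : 'F_p) (x : 'rV['F_p]_n),
              a != 0 -> f (a *: x) = a ^+ h * f x]].

Definition SQ (p : nat) : {set 'F_p} :=
  [set i | (i != 0) && [exists y : 'F_p, i == y ^+ 2]].

Definition NSQ (p : nat) : {set 'F_p} :=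
  [set i | (i != 0) && ~~ [exists y : 'F_p, i == y ^+ 2]].

Definition orth_compl (p n : nat) (S : {set 'rV['F_p]_n}) :
    {set 'rV['F_p]_n} :=
  [set x | [forall y in S, dot x y == 0]].

Definition nondegenerate (p n : nat) (V : {vspace 'rV['F_p]_n}) : Prop :=
  forall x : 'rV['F_p]_n,
    x \in V -> (forall y : 'rV['F_p]_n, y \in V -> dot x y = 0) -> x = 0.

Definition nondegenerate_subspace (p n r : nat) (S : {set 'rV['F_p]_n}) :
    Prop :=
  exists V : {vspace 'rV['F_p]_n},
    [/\ S = [set x | x \in V], \dim V = r & nondegenerate V].

(* [partition] forbids empty blocks; [uniq] makes the listed blocks distinct, so
   that a k-tuple stands for a partition into exactly k blocks. *)
Definition tuple_partition (T : finType) (k : nat) (U : k.-tuple {set T}) :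
    Prop :=
  uniq U /\ partition [set A in U] [set: T].

Definition transpose (X : finType) (R : {set X * X}) : {set X * X} :=
  [set xy | (xy.2, xy.1) \in R].

Definition association_scheme (X : finType) (d : nat)
    (R : d.+1.-tuple {set X * X}) : Prop :=
  [/\ (0 < #|X|)%N,
      tuple_partition R,
      tnth R ord0 = [set xy | xy.1 == xy.2],
      forall j : 'I_d.+1,
        exists j' : 'I_d.+1, transpose (tnth R j) = tnth R j'
    & forall u v w : 'I_d.+1, exists c : nat, forall x y : X,
        (x, y) \in tnth R w ->
        #|[set z | ((x, z) \in tnth R u) && ((z, y) \in tnth R v)]| = c].

Definition symmetric_association_scheme (X : finType) (d : nat)
    (R : d.+1.-tuple {set X * X}) : Prop :=
  association_scheme R /\
  forall j : 'I_d.+1, transpose (tnth R j) = tnth R j.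

Definition induces_symmetric_scheme (p n d : nat)
    (U : d.+1.-tuple {set 'rV['F_p]_n}) : Prop :=
  [/\ tuple_partition U,
      tnth U ord0 = [set 0]
    & symmetric_association_scheme
        [tuple [set ab : 'rV['F_p]_n * 'rV['F_p]_n
               | ab.1 - ab.2 \in tnth U i] | i < d.+1]].

Definition U4 (p n : nat) (f : 'rV['F_p]_n -> 'F_p) :
    8.-tuple {set 'rV['F_p]_n} :=
  [tuple [set 0];
         orth_compl (Bplus f) :\ 0;
         cset f 0 :\: orth_compl (Bplus f);
         \bigcup_(i in SQ p) cset f i;
         \bigcup_(i in NSQ p) cset f i;
         dset f 0;
         \bigcup_(i in SQ p) dset f i;
         \bigcup_(i in NSQ p) dset f i].

Definition U5 (p n : nat) (f : 'rV['F_p]_n -> 'F_p) :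
    6.-tuple {set 'rV['F_p]_n} :=
  [tuple [set 0];
         orth_compl (Bplus f) :\ 0;
         cset f 0 :\: orth_compl (Bplus f);
         \bigcup_(i : 'F_p | i != 0) cset f i;
         dset f 0;
         \bigcup_(i : 'F_p | i != 0) dset f i].

(* Main.v *)
Require Import Defs.
From HB Require Import structures.
From mathcomp Require Import all_boot all_order all_algebra all_field.
From mathcomp Require Import cyclic ring zify.

Set Implicit Arguments.
Unset Strict Implicit.
Unset Printing Implicit Defensive.

Import Order.TTheory GRing.Theory Num.Theory.

Local Open Scope ring_scope.

(* Write q = p^(n/2), V = B_+(f) and W = B_+(f-dual).  Adding and subtracting the
   Walsh transform of f and the Fourier inverse of that of its dual g shows that
   the sum of chi(f x + a.x) over x in W is q chi(g a) if a is in V and 0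
   otherwise, and that the sum over the complement of W is 0 or - q chi(g a)
   accordingly.  At a = 0 and along the orthogonal of V this forces V^orth to lie
   in W and f to vanish on it.  Applying Galois automorphisms of Q(xi) and the
   homogeneity of g, the character sums over the level sets c_j, d_j become
   explicit functions of (a = 0, a in W^orth, a in V, g a), so that the character
   sums over the blocks built from f are constant on the blocks built from g.
   Since (f, V) and (g, W) play symmetric roles, the converse holds too, and two
   partitions related in this way are both translation schemes.

   That Walsh values of a bent function are signed multiples of q by powers of xi
   follows from p being totally ramified in Z[xi]; parity of the number of
   solutions then yields that the dual of the dual is f and that g 0 = 0. *)

(** * The additive character of the prime field *)

Definition chi (p : nat) (c : 'F_p) : algC := xi p ^+ c.

Section AdditiveCharacter.

Variables (p : nat) (p_prime : prime p) (p_odd : odd p).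

Let p_gt0 : (0 < p)%N := prime_gt0 p_prime.

(** The order of [xi p] divides the prime [p]; order 1 would make the chosen [p]-th root of -1 equal
    to 1 or -1, and both are excluded. *)
Lemma xi_prim : p.-primitive_root (xi p).
Proof.
have xi1 : xi p ^+ p = 1.
  by rewrite /xi -exprM mulnC exprM rootCK // sqrrN expr1n.
have [m prim_m m_dvd] := prim_order_exists p_gt0 xi1.
have [_ /(_ m m_dvd)/orP[]/eqP m_eq] := primeP p_prime; last first.
  by move: prim_m; rewrite m_eq.
have := prim_expr_order prim_m; rewrite m_eq expr1 /xi => /eqP.
rewrite sqrf_eq1 => /orP[] /eqP root_eq.
  have := rootCK p_gt0 (-1 : algC); rewrite root_eq expr1n => /eqP.
  by rewrite -subr_eq0 opprK (pnatr_eq0 _ 2).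
(* The chosen root has maximal real part among the [p]-th roots of -1 with nonnegative imaginary
   part. If it were -1, comparison with [- w] or its conjugate would give ['Re w >= 1], hence
   [w = 1]. *)
have [w prim_w] := C_prim_root_exists p_gt0.
have w1 : w ^+ p = 1 := prim_expr_order prim_w.
have nw1 : `|w| = 1 by apply/eqP; rewrite -(pexpr_eq1 p_gt0) // -normrX w1 normr1.
have expN (y : algC) : y ^+ p = 1 -> (- y) ^+ p = -1.
  by move=> y1; rewrite exprNn y1 mulr1 -signr_odd p_odd.
have re_w : 1 <= 'Re w.
  rewrite -lerN2 -[leRHS](_ : 'Re (-1 : algC) = _); last first.
    by rewrite raddfN /= (Creal_ReP _ _) // rpred1.
  have [im_w | im_w] := real_leP (rpred0 _) (Creal_Im w).
    have im_w' : 0 <= 'Im (- w^*) by rewrite raddfN /= Im_conj opprK.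
    have := rootC_Re_max p_gt0 (expN (w^*) _) im_w'.
    rewrite root_eq ['Re (- _)]raddfN /= Re_conj; apply.
    by rewrite -rmorphXn w1 rmorph1.
  have im_w' : 0 <= 'Im (- w) by rewrite raddfN oppr_ge0 ltW.
  have := rootC_Re_max p_gt0 (expN w w1) im_w'.
  by rewrite root_eq ['Re (- _)]raddfN.
have [re_le /esym w_ge0] := leif_Re_Creal w.
have re1 : 'Re w = 1 by apply/eqP; rewrite eq_le re_w -[leRHS]nw1 re_le.
move: w_ge0; rewrite re1 nw1 eqxx => w_ge0.
have w_eq1 : w = 1 by rewrite -nw1 ger0_norm.
have := prim_order_dvd prim_w 1; rewrite expr1 w_eq1 eqxx dvdn1 => /eqP p1.
by move: p_prime; rewrite p1.
Qed.

Let xi1 : xi p ^+ p = 1 := prim_expr_order xi_prim.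

Lemma chi_nat k : chi (k%:R : 'F_p) = xi p ^+ k.
Proof. by rewrite /chi val_Fp_nat // expr_mod. Qed.

Lemma chi0 : chi (0 : 'F_p) = 1.
Proof. exact: expr0. Qed.

Lemma chiD : {morph @chi p : a b / a + b >-> a * b}.
Proof.
move=> a b; rewrite -(natr_Zp a) -(natr_Zp b) -natrD !chi_nat.
by rewrite exprD.
Qed.

Lemma chi_neq0 (c : 'F_p) : chi c != 0.
Proof.
by rewrite expf_neq0 // (prim_root_eq0 xi_prim) -lt0n.
Qed.

Lemma chiN (c : 'F_p) : chi (- c) = (chi c)^-1.
Proof.
by apply: (mulIf (chi_neq0 c)); rewrite -chiD addNr chi0 mulVf ?chi_neq0.
Qed.

Lemma chiX (c : 'F_p) k : chi (c *+ k) = chi c ^+ k.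
Proof. by elim: k => [|k IH]; rewrite ?chi0 // mulrS chiD IH exprS. Qed.

Lemma chi_expp (c : 'F_p) : chi c ^+ p = 1.
Proof. by rewrite /chi exprAC xi1 expr1n. Qed.

Lemma chi_norm (c : 'F_p) : `|chi c| = 1.
Proof.
by apply/eqP; rewrite -(pexpr_eq1 p_gt0) // -normrX chi_expp normr1.
Qed.

Lemma chi_conj (c : 'F_p) : (chi c)^* = chi (- c).
Proof. by rewrite chiN invC_norm chi_norm expr1n invr1 mul1r. Qed.

Lemma chi_eq1 (c : 'F_p) : (chi c == 1) = (c == 0).
Proof.
rewrite -[in LHS](natr_Zp c) chi_nat -(prim_order_dvd xi_prim).
rewrite [RHS](_ : _ = (c == 0 :> nat)); last by [].
have c_lt : (c < p)%N by rewrite -[ltnRHS](Fp_cast p_prime) ltn_ord.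
apply/idP/idP => [/dvdn_leq|/eqP->//].
by rewrite lt0n leqNgt c_lt; case: eqP => // _ /(_ isT).
Qed.

Lemma chi_inj : injective (@chi p).
Proof.
move=> a b ab; apply/eqP; rewrite -subr_eq0 -chi_eq1 chiD chiN ab.
by rewrite mulfV ?chi_neq0.
Qed.

Lemma sum_chi (s : 'F_p) : \sum_(y : 'F_p) chi (y * s) = p%:R * (s == 0)%:R.
Proof.
have [->|s_neq0] := eqVneq s 0.
  under eq_bigr do rewrite mulr0 chi0.
  by rewrite sumr_const card_Fp // mulr1.
rewrite mulr0; apply/eqP; have: chi s - 1 != 0 by rewrite subr_eq0 chi_eq1.
move/mulfI => mulI; apply/eqP/mulI; rewrite mulr0 mulrBl mul1r mulr_sumr.
rewrite [X in _ - X](reindex_inj (addrI 1)) /= -sumrB big1 // => y _.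
by rewrite -chiD mulrDl mul1r subrr.
Qed.

Lemma sum_chi_neq0 (s : 'F_p) :
  \sum_(y : 'F_p | y != 0) chi (y * s) = p%:R * (s == 0)%:R - 1.
Proof.
by rewrite -sum_chi [in RHS](bigD1 0) //= mul0r chi0 [1 + _]addrC addrK.
Qed.

Lemma Galois_chi (t : 'F_p) : t != 0 ->
  exists sigma : {rmorphism algC -> algC}, forall c, sigma (chi c) = chi (t * c).
Proof.
move=> t_neq0; have cop : coprime t p.
  rewrite coprime_sym prime_coprime // gtnNdvd ?lt0n //.
  by rewrite -[ltnRHS](Fp_cast p_prime) ltn_ord.
have [sigma sigmaE] := Qn_aut_exists cop.
exists sigma => c; rewrite sigmaE ?chi_expp //.
by rewrite -chiX -mulr_natl natr_Zp.
Qed.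

End AdditiveCharacter.

(** * Integers of the cyclotomic field *)

Section CyclotomicIntegers.

Variables (p : nat) (p_prime : prime p) (p_odd : odd p).

Let p_gt0 : (0 < p)%N := prime_gt0 p_prime.
Let prim_xi := xi_prim p_prime p_odd.
Let xi1 : xi p ^+ p = 1 := prim_expr_order prim_xi.

Definition int_poly_xi (P : {poly int}) : algC := (map_poly intr P).[xi p].

Definition Zxi (z : algC) : Prop := exists P, z = int_poly_xi P.

Lemma ZxiD y z : Zxi y -> Zxi z -> Zxi (y + z).
Proof.
by move=> [P ->] [Q ->]; exists (P + Q); rewrite /int_poly_xi rmorphD hornerD.
Qed.

Lemma ZxiM y z : Zxi y -> Zxi z -> Zxi (y * z).
Proof.
by move=> [P ->] [Q ->]; exists (P * Q); rewrite /int_poly_xi rmorphM hornerM.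
Qed.

Lemma Zxi_int m : Zxi m%:~R.
Proof. by exists m%:P; rewrite /int_poly_xi map_polyC hornerC. Qed.

Lemma Zxi_xi : Zxi (xi p).
Proof. by exists 'X; rewrite /int_poly_xi map_polyX hornerX. Qed.

Lemma ZxiX z k : Zxi z -> Zxi (z ^+ k).
Proof.
move=> Zz; elim: k => [|k IH]; first exact: Zxi_int 1.
by rewrite exprS; apply: ZxiM.
Qed.

Lemma Zxi_sum (I : Type) (r : seq I) (P : pred I) F :
  (forall i, P i -> Zxi (F i)) -> Zxi (\sum_(i <- r | P i) F i).
Proof. by apply: big_ind; [exact: Zxi_int 0 | exact: ZxiD]. Qed.

Lemma Zxi_prod (I : eqType) (r : seq I) F :
  (forall i, i \in r -> Zxi (F i)) -> Zxi (\prod_(i <- r) F i).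
Proof.
by rewrite big_seq; apply: big_ind; [exact: Zxi_int 1 | exact: ZxiM].
Qed.

Lemma Zxi_Aint z : Zxi z -> z \in Aint.
Proof.
move=> [P ->]; apply: rpred_horner; last exact: Aint_prim_root prim_xi.
by apply/polyOverP => i; rewrite coef_map /= Aint_int.
Qed.

Lemma subr1_xi_neq0 i : (0 < i < p)%N -> 1 - xi p ^+ i != 0.
Proof.
move=> /andP[i_gt0 i_lt]; rewrite subr_eq0 eq_sym -(prim_order_dvd prim_xi).
by rewrite gtnNdvd.
Qed.

(** Cancel ['X - 1] in the factorization of ['X^p - 1] and evaluate at 1. *)
Lemma prod_subr1_xi : \prod_(1 <= i < p) (1 - xi p ^+ i) = p%:R.
Proof.
have := factor_Xn_sub_1 prim_xi; rewrite big_ltn // expr0 subrX1 polyC1.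
have /mulfI mulI : 'X - 1 != 0 :> {poly algC} by rewrite -polyC1 polyXsubC_eq0.
move=> /mulI /(congr1 (fun P => P.[1])); rewrite horner_prod horner_sum.
under eq_bigr do rewrite hornerXsubC; move->.
by under eq_bigr do rewrite hornerXn expr1n; rewrite sumr_const card_ord.
Qed.

Let pi : algC := 1 - xi p.

Let pi_neq0 : pi != 0.
Proof. by rewrite /pi -[xi p]expr1 subr1_xi_neq0 // prime_gt1. Qed.

Lemma Zxi_p_over_pi : Zxi (p%:R / pi).
Proof.
rewrite -prod_subr1_xi big_ltn ?prime_gt1 // expr1 mulrAC mulfV // mul1r.
apply: Zxi_prod => i _; apply: ZxiD; first exact: Zxi_int 1.
by rewrite -mulN1r; apply: ZxiM; [exact: Zxi_int (-1) | apply/ZxiX/Zxi_xi].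
Qed.

(** Together with [Zxi_p_over_piX] this makes [p] and [pi ^+ p.-1] associates. Since [xi p] is a
    power of [xi p ^+ i], each factor [pi / (1 - xi p ^+ i)] is a geometric sum. *)
Lemma Zxi_piX_over_p : Zxi (pi ^+ p.-1 / p%:R).
Proof.
rewrite -prod_subr1_xi -subn1 -prodr_const_nat -prodf_div.
apply: Zxi_prod => i; rewrite mem_index_iota => i_bounds.
have i_neq0 : i%:R != 0 :> 'F_p.
  have := subr1_xi_neq0 i_bounds; rewrite -chi_nat // subr_eq0 eq_sym.
  by rewrite chi_eq1.
have xiE : xi p = (xi p ^+ i) ^+ ((i%:R)^-1 : 'F_p).
  by rewrite -chi_nat // -chiX // -[i%:R *+ _]mulr_natr natr_Zp mulfV //.
rewrite /pi -opprB -[X in _ / X]opprB invrN mulrNN {1}xiE subrX1 mulrAC mulfV.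
  by rewrite mul1r; apply: Zxi_sum => k _; apply/ZxiX/ZxiX/Zxi_xi.
by rewrite -oppr_eq0 opprB subr1_xi_neq0.
Qed.

Lemma Zxi_p_over_piX : Zxi (p%:R / pi ^+ p.-1).
Proof.
rewrite -prod_subr1_xi -subn1 -prodr_const_nat -prodf_div.
apply: Zxi_prod => i _; rewrite -opprB subrX1 -mulNr opprB mulrAC mulfV //.
by rewrite mul1r; apply: Zxi_sum => k _; apply/ZxiX/Zxi_xi.
Qed.

(* [pi] is a prime of Z[xi] above [p], with residue field F_p. *)
Lemma pi_dvd_int (m : int) k :
  (m%:~R ^+ k) / pi \in Aint -> (p %| m)%Z.
Proof.
move=> mk_div.
(* The power [p.-1] trades [pi] for [p]; the quotient is then a rational algebraic integer, hence an
   integer. *)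
have : (m ^+ (k * p.-1))%:~R / p%:R \in Aint.
  have -> : (m ^+ (k * p.-1))%:~R / p%:R =
            (m%:~R ^+ k / pi) ^+ p.-1 * (pi ^+ p.-1 / p%:R) :> algC.
    rewrite expr_div_n mulrA mulfVK ?expf_neq0 //.
    by rewrite rmorphXn /= exprM.
  by rewrite rpredM ?rpredX //; apply/Zxi_Aint/Zxi_piX_over_p.
move/Cint_rat_Aint => /(_ _)/intrP [|s /eqP].
  by rewrite rpred_div ?rpred_int ?rpred_nat.
rewrite -(inj_eq (mulIf (_ : p%:R != 0))) ?mulfVK ?pnatr_eq0 -?lt0n //.
rewrite -[p%:R]/(p%:Z%:~R) -intrM eqr_int => /eqP mE.
have : (p %| `|m| ^ (k * p.-1))%N.
  by rewrite -abszX mE abszM dvdn_mull.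
by rewrite Euclid_dvdX // => /andP[].
Qed.

(* Since [pi] and its conjugate are associate, [pi] divides [z] as soon as it
   divides [z * z^*]. *)
Lemma pi_adic_descent m z : Zxi z -> z * z^* / pi ^+ (m + m) \in Aint ->
  Zxi (z / pi ^+ m).
Proof.
elim: m z => [|m IH] z Zz; first by move=> _; rewrite expr0 divr1.
move=> zz_div.
have [P zE] := Zz.
(* Since [xi p] is 1 modulo [pi], the integer [P.[1]] represents the residue of [z]. *)
have [Q PE] : exists Q, P - (P.[1])%:P = Q * ('X - 1%:P).
  by apply/factor_theorem; rewrite /root !hornerE subrr.
have {PE}zE : z = P.[1]%:~R - pi * int_poly_xi Q.
  rewrite zE -[P](subrK P.[1]%:P) PE /int_poly_xi rmorphD rmorphM rmorphB /=.
  rewrite map_polyX !map_polyC /= !hornerE.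
  by rewrite addrC -mulNr opprB mulrC.
set c := P.[1] in zE; set b := int_poly_xi Q in zE.
have Zb : Zxi b by exists Q.
have xi_conj : (xi p) * (xi p)^* = 1.
  by rewrite -normCK -[xi p](chi_nat p_prime p_odd 1) chi_norm // expr1n.
have pi_conj : pi^* = - (xi p)^* * pi.
  by rewrite /pi rmorphB rmorph1 mulNr mulrBr mulr1 [_^* * _]mulrC xi_conj opprB.
have conjA y : y \in Aint -> y^* \in Aint by rewrite (Aint_aut Num.conj).
have Ax : xi p \in Aint := Zxi_Aint Zxi_xi.
have Ab : b \in Aint := Zxi_Aint Zb.
have Az : z \in Aint := Zxi_Aint Zz.
have Api : pi \in Aint by rewrite rpredB ?rpred1.
have conj_c : c%:~R^* = c%:~R :> algC by rewrite rmorph_int.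
(* Modulo [pi], both [z] and its conjugate reduce to [c], so [c ^+ 2] is congruent to [z * z^*],
   which [pi] divides. *)
have c_div : c%:~R ^+ 2 / pi \in Aint.
  have -> : c%:~R ^+ 2 / pi =
     z * z^* / pi ^+ (m.+1 + m.+1) * pi ^+ (m + m.+1)
       - (xi p)^* * c%:~R * b^* + b * z^*.
    rewrite -[(m.+1 + m.+1)%N]/(1 + (m + m.+1))%N exprD expr1.
    have : pi ^+ (m + m.+1) != 0 by rewrite expf_neq0.
    move: (pi ^+ (m + m.+1)) => M M_neq0.
    rewrite zE rmorphB rmorphM /= pi_conj conj_c.
    by field; rewrite M_neq0 pi_neq0.
  apply: rpredD; last by rewrite rpredM ?conjA.
  apply: rpredB; last by rewrite !rpredM ?conjA ?Aint_int.
  by apply: rpredM; last exact: rpredX.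
have /dvdzP[e cE] := pi_dvd_int c_div.
(* This is [z / pi], written so that it visibly lies in Z[xi]. *)
pose z1 := e%:~R * (p%:R / pi) - b.
have Z1 : Zxi z1.
  apply: ZxiD; first by apply: ZxiM; [exact: Zxi_int | exact: Zxi_p_over_pi].
  by rewrite -mulN1r; apply: ZxiM => //; exact: Zxi_int (-1).
have zE1 : z = pi * z1.
  by rewrite zE /z1 mulrBr cE intrM mulrCA [pi * (_ / _)]mulrC mulfVK.
have -> : z / pi ^+ m.+1 = z1 / pi ^+ m.
  by rewrite zE1 exprS invfM mulrACA mulfV // mul1r.
apply: IH => //.
have -> : z1 * z1^* / pi ^+ (m + m) =
   - xi p * (z * z^* / pi ^+ (m.+1 + m.+1)).
  rewrite zE1 rmorphM /= pi_conj addSn addnS !exprS -[LHS]mul1r -xi_conj.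
  have : pi ^+ (m + m) != 0 by rewrite expf_neq0.
  move: (pi ^+ (m + m)) => M M_neq0.
  by field; rewrite M_neq0 pi_neq0.
by apply: rpredM; first rewrite rpredN.
Qed.

(** Up to a unit, [z * z^*] is [pi] to the power [2 * p.-1 * k]; the descent extracts half of that
    power, which is [p%:R ^+ k] up to a unit. *)
Lemma Zxi_divp k z : Zxi z -> `|z| = p%:R ^+ k -> Zxi (z / p%:R ^+ k).
Proof.
move=> Zz z_norm.
have p_neq0 : p%:R != 0 :> algC by rewrite pnatr_eq0 -lt0n.
have -> : z / p%:R ^+ k =
          z / pi ^+ (p.-1 * k) * (pi ^+ p.-1 / p%:R) ^+ k.
  by rewrite expr_div_n exprM mulrA mulfVK // !expf_neq0.
apply: ZxiM; last by apply/ZxiX/Zxi_piX_over_p.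
apply: pi_adic_descent => //.
rewrite -normCK z_norm exprD !exprM -expr2 -expr_div_n -expr_div_n.
by apply/rpredX/rpredX/Zxi_Aint/Zxi_p_over_piX.
Qed.

End CyclotomicIntegers.

(** * Integer combinations of character values *)

Section ChiSums.

Variables (p : nat) (p_prime : prime p) (p_odd : odd p).

Let p_gt0 : (0 < p)%N := prime_gt0 p_prime.

Lemma Zxi_chi (c : 'F_p) : Zxi p (chi c).
Proof. exact/ZxiX/Zxi_xi. Qed.

Lemma Zxi_chi_expansion z : Zxi p z ->
  exists m : 'F_p -> int, z = \sum_(c : 'F_p) (m c)%:~R * chi c.
Proof.
move=> [P ->]; exists (fun c => \sum_(i < size P | i%:R == c) P`_i).
rewrite /int_poly_xi (@horner_coef_wide _ (size P)) ?size_poly //.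
rewrite (partition_big (fun i : 'I__ => i%:R : 'F_p) predT) //=.
apply: eq_bigr => c _; rewrite rmorph_sum mulr_suml /=.
apply: eq_bigr => i /eqP <-.
by rewrite coef_map /= chi_nat.
Qed.

Lemma chi_sum_inversion (m : 'F_p -> algC) (k : 'F_p) :
  \sum_(t : 'F_p) (\sum_(c : 'F_p) m c * chi (t * c)) * chi (- (t * k))
  = p%:R * m k.
Proof.
under eq_bigr do rewrite mulr_suml.
rewrite exchange_big /= (bigD1 k) //= [X in _ + X]big1 => [|c c_neq].
  rewrite addr0; under eq_bigr do rewrite -mulrA -chiD // subrr chi0 mulr1.
  by rewrite sumr_const card_Fp // mulr_natl.
under eq_bigr do rewrite -mulrA -chiD // -mulrBr.
by rewrite -mulr_sumr sum_chi // subr_eq0 (negPf c_neq) !mulr0.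
Qed.

Lemma chi_sum_parseval (m : 'F_p -> int) :
  \sum_(t : 'F_p) `|\sum_(c : 'F_p) (m c)%:~R * chi (t * c)| ^+ 2
  = p%:R * \sum_(c : 'F_p) (m c)%:~R ^+ 2.
Proof.
rewrite mulr_sumr.
transitivity (\sum_(t : 'F_p) \sum_(k : 'F_p)
   (\sum_(c : 'F_p) (m c)%:~R * chi (t * c)) * chi (- (t * k)) * (m k)%:~R).
  apply: eq_bigr => t _; rewrite normCK rmorph_sum /= mulr_sumr.
  apply: eq_bigr => k _.
  by rewrite rmorphM /= rmorph_int chi_conj // -mulrA [chi _ * _]mulrC.
rewrite exchange_big; apply: eq_bigr => k _ /=.
by rewrite -mulr_suml chi_sum_inversion expr2 mulrA.
Qed.

Lemma Galois_chi_sum (m : 'F_p -> int) (t : 'F_p) : t != 0 ->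
  exists sigma : {rmorphism algC -> algC},
    (forall c, sigma (chi c) = chi (t * c)) /\
    sigma (\sum_(c : 'F_p) (m c)%:~R * chi c) =
      \sum_(c : 'F_p) (m c)%:~R * chi (t * c).
Proof.
move=> t_neq0; have [sigma sigmaE] := Galois_chi p_prime p_odd t_neq0.
exists sigma; split=> //; rewrite rmorph_sum; apply: eq_bigr => c _.
by rewrite rmorphM /= rmorph_int sigmaE.
Qed.

(** In [chi_sum_inversion] the terms with [t != 0] are Galois conjugates of 0, and the remaining
    term does not depend on [k]. *)
Lemma chi_sum_eq0 (m : 'F_p -> int) :
  \sum_(c : 'F_p) (m c)%:~R * chi c = 0 -> forall k l, m k = m l.
Proof.
move=> sum0; have pmE k : p%:R * (m k)%:~R = \sum_(c : 'F_p) (m c)%:~R :> algC.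
  rewrite -(chi_sum_inversion (fun c => (m c)%:~R)) (bigD1 0) //=.
  rewrite [X in _ + X]big1 => [|t t_neq0].
    rewrite addr0 mul0r oppr0 chi0 mulr1.
    by apply: eq_bigr => c _; rewrite mul0r chi0 mulr1.
  have [sigma [_ <-]] := Galois_chi_sum m t_neq0.
  by rewrite sum0 rmorph0 mul0r.
move=> k l; apply: (@intr_inj algC); apply: (@mulfI _ p%:R); last by rewrite !pmE.
by rewrite pnatr_eq0 -lt0n.
Qed.

(** On Q(xi), Galois automorphisms commute with complex conjugation, so the conjugates of a number
    of modulus 1 have modulus 1. *)
Lemma norm1_chi_sum (m : 'F_p -> int) (t : 'F_p) : t != 0 ->
  `|\sum_(c : 'F_p) (m c)%:~R * chi c| = 1 ->
  `|\sum_(c : 'F_p) (m c)%:~R * chi (t * c)| = 1.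
Proof.
move=> t_neq0 norm1; have [sigma [sigmaE sumE]] := Galois_chi_sum m t_neq0.
apply/eqP; rewrite -sqrp_eq1 // -sumE normCK.
have -> : (sigma (\sum_(c : 'F_p) (m c)%:~R * chi c))^* =
          sigma (\sum_(c : 'F_p) (m c)%:~R * chi c)^*.
  rewrite sumE !rmorph_sum /=; apply: eq_bigr => c _.
  by rewrite !rmorphM /= !rmorph_int !chi_conj // sigmaE mulrN.
by rewrite -rmorphM -normCK norm1 expr1n rmorph1.
Qed.

Lemma sum_sqr_eq1 (m : 'F_p -> int) : \sum_(c : 'F_p) m c ^+ 2 = 1 ->
  exists c0, m c0 ^+ 2 = 1 /\ forall c, c != c0 -> m c = 0.
Proof.
move=> sum1.
have [c0 c0_neq0] : exists c0, m c0 != 0.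
  apply/existsP; apply: contraTT isT; rewrite negb_exists => /forallP m0.
  move: sum1; rewrite big1 // => c _; move: (m0 c); rewrite negbK => /eqP ->.
  by rewrite expr0n.
have sqr_ge1 : 1 <= m c0 ^+ 2.
  by rewrite -gtz0_ge1 lt_neqAle sqr_ge0 eq_sym expf_neq0.
move: sum1; rewrite (bigD1 c0) //= => sum1.
have rest_ge0 : 0 <= \sum_(c | c != c0) m c ^+ 2.
  by apply: sumr_ge0 => c _; exact: sqr_ge0.
have m1 : m c0 ^+ 2 = 1.
  by apply/eqP; rewrite eq_le sqr_ge1 andbT -sum1 lerDl.
exists c0; split=> // c c_neq; move: sum1; rewrite m1 -[RHS]addr0 => /addrI.
move/psumr_eq0P => /(_ (fun c _ => sqr_ge0 _)) /(_ c c_neq)/eqP.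
by rewrite sqrf_eq0 => /eqP.
Qed.

(* Parseval, applied to the coefficients normalised so that they add up to a
   number in {1, -1}, replaces Kronecker's theorem on roots of unity. *)
Lemma Zxi_norm1 z : Zxi p z -> `|z| = 1 ->
  exists (s : bool) (c : 'F_p), z = (-1) ^+ s * chi c.
Proof.
move=> /Zxi_chi_expansion[m zE] norm1.
have parseval (l : 'F_p -> int) : z = \sum_(c : 'F_p) (l c)%:~R * chi c ->
    p%:Z * \sum_c l c ^+ 2 = (\sum_c l c) ^+ 2 + (p%:Z - 1).
  move=> zE'; apply: (@intr_inj algC).
  rewrite intrM rmorph_sum /=; under eq_bigr do rewrite rmorphXn /=.
  rewrite -chi_sum_parseval (bigD1 0) //=.
  rewrite rmorphD rmorphXn rmorph_sum rmorphB rmorph1 /=; congr (_ + _).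
    under eq_bigr do rewrite mul0r chi0 mulr1.
    by rewrite real_normK // rpred_sum // => c _; rewrite rpred_int.
  under eq_bigr => t t_neq0 do rewrite norm1_chi_sum -?zE' // expr1n.
  have : \sum_(t : 'F_p) 1 = (p%:Z)%:~R :> algC by rewrite sumr_const card_Fp.
  by rewrite (bigD1 0) //= => <-; rewrite [1 + _]addrC addrK.
(* Modulo [p], the Parseval identity says that the square of the sum of the coefficients is 1. *)
have [s [k sumE]] : exists (s : bool) (k : int), \sum_c m c = (-1) ^+ s + k * p%:Z.
  have : (p%:Z %| (\sum_c m c - 1) * (\sum_c m c + 1))%Z.
    apply/dvdzP; exists (\sum_c m c ^+ 2 - 1).
    by rewrite [RHS]mulrBl mul1r [_ * p%:Z]mulrC parseval //; ring.
  rewrite dvdzE abszM Euclid_dvdM // -!dvdzE => /orP[]/dvdzP[k kE].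
    by exists false, k; rewrite -kE addrC subrK.
  by exists true, k; rewrite -kE addrC addrK.
(* As the values of [chi] add up to 0, this shift keeps [z], while it lowers the sum of the
   coefficients by [k * p]. *)
pose l c := m c - k.
have zE' : z = \sum_(c : 'F_p) (l c)%:~R * chi c.
  rewrite /l; under eq_bigr do rewrite rmorphB mulrBl.
  rewrite sumrB -zE -mulr_sumr; have := sum_chi p_prime p_odd 1.
  by under eq_bigr do rewrite mulr1; move=> ->; rewrite oner_eq0 !mulr0 subr0.
have suml : \sum_c l c = (-1) ^+ s.
  by rewrite sumrB sumE sumr_const card_Fp // -mulr_natr natz addrK.
(* The right-hand side becomes [1 + (p - 1)], so the squares of the coefficients add up to 1 and a
   single coefficient survives. *)
have := parseval l zE'; rewrite suml sqrr_sign addrC subrK.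
have p_neq0 : p%:Z != 0 by rewrite eqz_nat -lt0n.
rewrite -[RHS]mulr1 => /(mulfI p_neq0)/sum_sqr_eq1[c0 [l_c0 l0]].
move: zE'; rewrite (bigD1 c0) //= [X in _ + X]big1 ?addr0 => [zE'|c /l0->]; last first.
  by rewrite mul0r.
move/eqP: l_c0; rewrite sqrf_eq1 => /orP[]/eqP l_c0; move: zE'; rewrite l_c0.
  by exists false, c0; rewrite expr0.
by exists true, c0; rewrite expr1 zE' rmorphN1.
Qed.

End ChiSums.

(** * Characters of the vector space and translation schemes *)

Section Dot.

Variables p n : nat.
Implicit Types x y z : 'rV['F_p]_n.

Lemma dotC x y : dot x y = dot y x.
Proof. by apply: eq_bigr => i _; rewrite mulrC. Qed.

Lemma dotDr x y z : dot x (y + z) = dot x y + dot x z.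
Proof. by rewrite -big_split; apply: eq_bigr => i _; rewrite mxE mulrDr. Qed.

Lemma dotZr c x y : dot x (c *: y) = c * dot x y.
Proof. by rewrite mulr_sumr; apply: eq_bigr => i _; rewrite mxE mulrCA. Qed.

Lemma dotNr x y : dot x (- y) = - dot x y.
Proof. by rewrite -scaleN1r dotZr mulN1r. Qed.

Lemma dot0r x : dot x 0 = 0.
Proof. by rewrite -(scale0r 0) dotZr mul0r. Qed.

Lemma dotDl x y z : dot (x + y) z = dot x z + dot y z.
Proof. by rewrite dotC dotDr ![dot z _]dotC. Qed.

Lemma dotZl c x y : dot (c *: x) y = c * dot x y.
Proof. by rewrite dotC dotZr dotC. Qed.

Lemma dotNl x y : dot (- x) y = - dot x y.
Proof. by rewrite dotC dotNr dotC. Qed.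

Lemma dot0l x : dot 0 x = 0.
Proof. by rewrite dotC dot0r. Qed.

End Dot.

Definition vset (p n : nat) (U : {vspace 'rV['F_p]_n}) : {set 'rV['F_p]_n} :=
  [set x | x \in U].

Section VectorCharacters.

Variables (p n : nat) (p_prime : prime p) (p_odd : odd p).
Implicit Types (a x y : 'rV['F_p]_n) (U : {vspace 'rV['F_p]_n}).

Let p_gt0 : (0 < p)%N := prime_gt0 p_prime.

Lemma orth_complP U a :
  reflect (forall y, y \in U -> dot a y = 0) (a \in orth_compl (vset U)).
Proof.
rewrite inE; apply: (iffP forallP) => [H y yU | H y].
  by have /implyP := H y; rewrite inE => /(_ yU)/eqP.
by apply/implyP; rewrite inE => /H ->.
Qed.

Lemma card_vset U : #|U| = (p ^ \dim U)%N.
Proof. by rewrite card_vspace card_Fp. Qed.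

Lemma sum_chi_vspace U a :
  \sum_(x in U) chi (dot a x) =
  (p ^ \dim U)%:R * (a \in orth_compl (vset U))%:R.
Proof.
case: orth_complP => [orth | /orth_complP].
  rewrite mulr1 -card_vset -sumr_const; apply: eq_bigr => x xU.
  by rewrite orth // chi0.
rewrite mulr0 inE negb_forall => /existsP[y].
rewrite negb_imply inE => /andP[yU ay_neq0].
have : chi (dot a y) - 1 != 0 by rewrite subr_eq0 chi_eq1.
move/mulfI; apply; rewrite mulr0 mulrBl mul1r mulr_sumr.
rewrite [X in _ - X](reindex_inj (addrI y)) /=.
rewrite [X in _ - X](eq_bigl (fun x => x \in U)) => [|x]; last exact: rpredDl.
by rewrite -sumrB big1 // => x _; rewrite dotDr chiD // subrr.
Qed.

Lemma orth_fullv a : (a \in orth_compl (vset fullv)) = (a == 0).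
Proof.
apply/orth_complP/eqP => [orth | -> y _]; last exact: dot0l.
apply/rowP => i; rewrite mxE -[RHS](orth (delta_mx 0 i)) ?memvf //.
rewrite /dot (bigD1 i) //= big1 => [|j j_neq].
  by rewrite mxE !eqxx mulr1 addr0.
by rewrite mxE eqxx (negPf j_neq) mulr0.
Qed.

Lemma sum_chi_dot a : \sum_x chi (dot a x) = (p ^ n)%:R * (a == 0)%:R.
Proof.
have := sum_chi_vspace fullv a.
rewrite orth_fullv dimvf /dim /= mul1n => <-.
by apply: eq_bigl => x; rewrite memvf.
Qed.

Lemma expn_p_neq0 : (p ^ n)%:R != 0 :> algC.
Proof. by rewrite pnatr_eq0 expn_eq0 negb_and -lt0n p_gt0. Qed.

Lemma Fourier_inversion (F : 'rV['F_p]_n -> algC) x :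
  \sum_a (\sum_y F y * chi (- dot a y)) * chi (dot a x) = (p ^ n)%:R * F x.
Proof.
under eq_bigr do rewrite mulr_suml.
rewrite exchange_big /= (bigD1 x) //= [X in _ + X]big1 => [|y y_neq].
  rewrite addr0; under eq_bigr do rewrite -mulrA -chiD // addNr chi0 mulr1.
  by rewrite sumr_const card_mx card_Fp // mul1n mulr_natl.
under eq_bigr do rewrite -mulrA -chiD // addrC -dotNr -dotDr dotC.
by rewrite -mulr_sumr sum_chi_dot subr_eq0 eq_sym (negPf y_neq) !mulr0.
Qed.

(** Evaluate the double sum of [chi (dot x (y + a))] over all [x] and over [y] in [U] in both
    orders: summing over [y] first detects orthogonality to [U], summing over [x] first leaves only
    [y = - a]. *)
Lemma sum_chi_orth U a :
  \sum_(x in orth_compl (vset U)) chi (dot a x) =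
  (p ^ n)%:R / (p ^ \dim U)%:R * (a \in U)%:R.
Proof.
have pU_neq0 : (p ^ \dim U)%:R != 0 :> algC.
  by rewrite pnatr_eq0 expn_eq0 negb_and -lt0n p_gt0.
apply: (mulfI pU_neq0); rewrite mulrA [_ / _]mulrC mulVKf //.
transitivity (\sum_x (\sum_(y in U) chi (dot x y)) * chi (dot a x)).
  rewrite mulr_sumr big_mkcond; apply: eq_bigr => x _ /=.
  by rewrite sum_chi_vspace; case: ifP; rewrite (mulr1, mulr0) ?mul0r.
under eq_bigr do rewrite mulr_suml.
rewrite exchange_big /=.
under eq_bigr => y yU.
  under eq_bigr do rewrite -chiD // dotC -dotDl.
  rewrite sum_chi_dot addr_eq0.
over.
rewrite -mulr_sumr; congr (_ * _).
have [aU | aU] := boolP (a \in U).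
  rewrite (bigD1 (- a)) ?memvN //= eqxx big1 ?addr0 // => y /andP[_].
  by move/negPf->.
rewrite big1 // => y yU; case: eqP => // yE; case/negP: aU.
by rewrite -memvN -yE.
Qed.

End VectorCharacters.

(** * Partitions and translation schemes given by a labelling *)

Lemma label_partition (T : finType) d (U : d.+1.-tuple {set T}) (l : T -> nat) :
    (forall x, (l x <= d)%N) ->
    (forall i : 'I_d.+1, tnth U i = [set x | l x == i]) ->
    (forall i : 'I_d.+1, exists x, l x = i) ->
  tuple_partition U.
Proof.
move=> l_le UE l_surj; split.
  apply/(uniqP set0) => i j; rewrite !inE size_tuple => i_lt j_lt.
  have nthE (k : 'I_d.+1) : nth set0 U k = [set x | l x == k].
    by rewrite -UE (tnth_nth set0).
  rewrite -[i]/(val (Ordinal i_lt)) -[j]/(val (Ordinal j_lt)) !nthE.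
  have [x xE] := l_surj (Ordinal i_lt).
  by move/setP/(_ x); rewrite !inE xE eqxx => /esym/eqP.
have UP B : reflect (exists i : 'I_d.+1, B = [set x | l x == i]) (B \in U).
  by apply: (iffP (tnthP U B)) => -[i ->]; exists i; rewrite UE.
apply/and3P; split.
- apply/eqP/setP => x; rewrite inE; apply/bigcupP.
  exists [set y | l y == l x]; rewrite inE //.
  have l_lt : (l x < d.+1)%N by rewrite ltnS.
  by apply/UP; exists (Ordinal l_lt).
- apply/trivIsetP => A B; rewrite !inE => /UP[i ->] /UP[j ->] AB_neq.
  apply/pred0P => x /=; rewrite !inE; apply/negP => /andP[/eqP-> /eqP ij].
  by rewrite ij eqxx in AB_neq.
rewrite inE; apply/negP => /UP[i /setP setE].
by have [x xE] := l_surj i; have := setE x; rewrite !inE xE eqxx.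
Qed.

Section LabelScheme.

Variables (p n d : nat) (p_prime : prime p) (p_odd : odd p).
Implicit Types (a x y : 'rV['F_p]_n) (l : 'rV['F_p]_n -> nat).

Definition label_sum l (i : nat) a : algC := \sum_(x | l x == i) chi (dot a x).

(** Grouping by the blocks of [l'], on which [F] is constant, turns the transform of [F] into a
    linear combination of the block sums of [l']. *)
Lemma sum_class_function l' l (F : 'rV['F_p]_n -> algC) :
    (forall x, (l' x <= d)%N) ->
    (forall a b, l' a = l' b -> F a = F b) ->
    (forall i x y, l x = l y -> label_sum l' i x = label_sum l' i y) ->
  forall x y, l x = l y ->
    \sum_a F a * chi (dot x a) = \sum_a F a * chi (dot y a).
Proof.
move=> l'_le F_const l'_sums x y l_eq.
rewrite !(partition_big (fun a => inord (l' a) : 'I_d.+1) predT) //=.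
apply: eq_bigr => i _.
have inordE a : (inord (l' a) == i) = (l' a == i).
  by rewrite -val_eqE /= inordK // ltnS.
rewrite !(eq_bigl _ _ inordE).
have [a0 a0E | no_a] := pickP (fun a => l' a == i); last by rewrite !big_pred0.
have FE z : \sum_(a | l' a == i) F a * chi (dot z a) = F a0 * label_sum l' i z.
  rewrite mulr_sumr; apply: eq_bigr => a /eqP aE.
  by rewrite (F_const a a0) // aE (eqP a0E).
by rewrite !FE (l'_sums _ _ _ l_eq).
Qed.

(* The criterion of Bridges and Mena: when the character sums over the blocks
   of two partitions are constant on the blocks of each other, convolution of
   block indicators becomes the pointwise product on the other side, and the
   span of the indicators is closed under it. *)
Lemma label_scheme (U : d.+1.-tuple {set 'rV['F_p]_n}) l l' :
    (forall x, (l x <= d)%N) ->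
    (forall a, (l' a <= d)%N) ->
    (forall i : 'I_d.+1, tnth U i = [set x | l x == i]) ->
    (forall i : 'I_d.+1, exists x, l x = i) ->
    (forall x, (l x == 0) = (x == 0)) ->
    (forall x, l (- x) = l x) ->
    (forall i a b, l' a = l' b -> label_sum l i a = label_sum l i b) ->
    (forall i x y, l x = l y -> label_sum l' i x = label_sum l' i y) ->
  induces_symmetric_scheme U.
Proof.
move=> l_le l'_le UE l_surj l0 lN l_sums l'_sums.
have RE (i : 'I_d.+1) : tnth [tuple [set ab : 'rV['F_p]_n * 'rV['F_p]_n
               | ab.1 - ab.2 \in tnth U i] | i < d.+1] i
       = [set ab | l (ab.1 - ab.2) == i].
  by rewrite tnth_mktuple UE; apply/setP => ab; rewrite !inE.
split; first exact: label_partition UE l_surj.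
  by apply/setP => x; rewrite UE !inE l0.
have tr (i : 'I_d.+1) : transpose [set ab | l (ab.1 - ab.2) == i] =
                        [set ab | l (ab.1 - ab.2) == i].
  by apply/setP => ab; rewrite !inE /= -lN opprB.
split; last by move=> j; rewrite RE tr.
split.
- by apply/card_gt0P; exists 0.
- apply: (label_partition (l := fun ab => l (ab.1 - ab.2))) => // i.
  by have [x xE] := l_surj i; exists (x, 0); rewrite subr0.
- by rewrite RE; apply/setP => ab; rewrite !inE l0 subr_eq0.
- by move=> j; exists j; rewrite RE tr.
move=> u v w.
pose N x := #|[set s | (l s == u) && (l (x - s) == v)]|.
have countE x y :
    #|[set z | ((x, z) \in [set ab | l (ab.1 - ab.2) == u]) &&
               ((z, y) \in [set ab | l (ab.1 - ab.2) == v])]| = N (x - y).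
  rewrite /N -[RHS](card_imset _ (can_inj (subKr x))); apply: eq_card => z.
  rewrite !inE /=; apply/andP/imsetP => [[xzu zyv] | [s + ->]].
    exists (x - z); last by rewrite subKr.
    by rewrite inE xzu opprB addrC addrA subrK.
  by rewrite inE subKr addrAC => /andP[].
(* Fourier expansion of the condition [s + t = x]: the count of such pairs is the transform of the
   product of two block sums. *)
have NE x : (p ^ n)%:R * (N x)%:R =
   \sum_a (label_sum l u a * label_sum l v a) * chi (dot (- x) a) :> algC.
  transitivity (\sum_(s | l s == u) \sum_(t | l t == v)
                  \sum_a chi (dot (s + t - x) a)).
    rewrite /N cardsE -sum1_card natr_sum mulr_sumr big_mkcondr /=.
    apply: eq_bigr => s su; under eq_bigr do rewrite sum_chi_dot // subr_eq0.
    have [sv | sv] := ifPn.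
      rewrite (bigD1 (x - s)) //= [s + (x - s)]addrC subrK eqxx.
      rewrite big1 ?addr0 // => t /andP[_ t_neq]; case: eqP => [stE|].
        by rewrite -stE [s + t]addrC addrK eqxx in t_neq.
      by rewrite mulr0.
    rewrite big1 // => t tv; case: eqP => [stE|]; last by rewrite mulr0.
    by rewrite -stE [s + t]addrC addrK tv in sv.
  under [RHS]eq_bigr do rewrite /label_sum mulr_suml mulr_suml.
  rewrite [RHS]exchange_big /=; apply: eq_bigr => s su.
  under [RHS]eq_bigr do rewrite mulr_sumr mulr_suml.
  rewrite [RHS]exchange_big /=; apply: eq_bigr => t tv; apply: eq_bigr => a _.
  by rewrite !dotDl !chiD // ![dot a _]dotC.
have N_const x y : l x = l y -> N x = N y.
  move=> l_eq; apply/eqP; rewrite -(eqr_nat algC).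
  apply/eqP/(mulfI (expn_p_neq0 n p_prime)); rewrite !NE.
  apply: (sum_class_function l'_le _ l'_sums); last by rewrite !lN.
  by move=> a b ab; rewrite !(l_sums _ _ _ ab).
have [x0 x0E] := l_surj w; exists (N x0) => x y.
rewrite !RE inE /= => /eqP xyE; rewrite countE.
by apply: N_const; rewrite xyE x0E.
Qed.

End LabelScheme.

(** * Walsh values of bent functions *)

Section BentFunctions.

Variables (p n : nat) (p_prime : prime p) (p_odd : odd p) (n_even : ~~ odd n).
Implicit Types (f : 'rV['F_p]_n -> 'F_p) (a x : 'rV['F_p]_n).

Let p_gt0 : (0 < p)%N := prime_gt0 p_prime.

Lemma sqrt_pnE : sqrt_pn p n = p%:R ^+ n./2.
Proof.
rewrite /sqrt_pn -[in LHS](even_halfK n_even) -mul2n exprM.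
by rewrite sqrtCK.
Qed.

Local Notation q := (sqrt_pn p n).

Lemma sqrt_pn_neq0 : q != 0.
Proof. by rewrite sqrt_pnE expf_neq0 // pnatr_eq0 -lt0n. Qed.

Lemma sqrt_pn_sqr : q ^+ 2 = (p ^ n)%:R.
Proof.
by rewrite sqrt_pnE -exprM muln2 even_halfK // natrX.
Qed.

Lemma mu_even : mu p n = 1.
Proof.
rewrite /mu -(even_halfK n_even) -muln2 mulnC expnM -modnXm.
have -> : (p ^ 2 %% 4 = 1)%N.
  rewrite -(odd_double_half p) p_odd -mul2n; lia.
by rewrite exp1n.
Qed.

(** The [p]-th power kills [chi] and, [p] being odd, keeps the sign. *)
Lemma sign_chi_inj (s s' : bool) (c c' : 'F_p) :
  (-1) ^+ s * chi c = (-1) ^+ s' * chi c' -> s = s' /\ c = c'.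
Proof.
move=> E; have ss' : s = s'.
  move/(congr1 (fun z => z ^+ p)): E; rewrite !exprMn !chi_expp // !mulr1.
  rewrite -!exprM -[in LHS]signr_odd -[in RHS]signr_odd !oddM p_odd !andbT !oddb.
  exact: signr_inj.
split=> //; move: E; rewrite ss' => /mulfI E; apply: (chi_inj p_prime p_odd).
by apply: E; rewrite signr_eq0.
Qed.

Lemma signed_chi_inj (s s' : bool) (c c' : 'F_p) :
  (-1) ^+ s * (q * chi c) = (-1) ^+ s' * (q * chi c') -> s = s' /\ c = c'.
Proof.
rewrite mulrCA [RHS]mulrCA => /(mulfI sqrt_pn_neq0).
exact: sign_chi_inj.
Qed.

Lemma bent_walsh f a : bent f ->
  exists (s : bool) (c : 'F_p), walsh f a = (-1) ^+ s * (q * chi c).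
Proof.
move=> f_bent; have Zw : Zxi p (walsh f a).
  by apply: Zxi_sum => x _; exact: Zxi_chi.
have := f_bent a; rewrite sqrt_pnE => w_norm.
have p_neq0 : p%:R ^+ n./2 != 0 :> algC by rewrite -sqrt_pnE sqrt_pn_neq0.
have [||s [c wE]] := @Zxi_norm1 p p_prime p_odd (walsh f a / p%:R ^+ n./2).
- exact: Zxi_divp.
- by rewrite normf_div w_norm ger0_norm ?divff // exprn_ge0.
by exists s, c; rewrite [RHS]mulrCA -wE mulrCA mulfV ?mulr1.
Qed.

Lemma walsh_dual f a : bent f ->
  walsh f a = (-1) ^+ (a \notin Bplus f) * (q * chi (dual f a)).
Proof.
move=> f_bent; rewrite inE mu_even mul1r -/(chi _).
case: eqP => [->|w_neq]; first by rewrite expr0 mul1r.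
rewrite expr1 mulN1r; move: w_neq; rewrite /dual.
case: pickP => [c|/= none]; rewrite /= ?mu_even ?mul1r -/(chi _).
  by move=> /orP[/eqP->|/eqP->].
(* The shape of Walsh values shows that the [pick] in [dual] cannot fail. *)
have [s [c wE]] := bent_walsh a f_bent.
have := none c; rewrite mu_even mul1r -/(chi _) wE.
by case: s {wE} => /=; rewrite ?expr1 ?expr0 ?mulN1r ?mul1r eqxx ?orbT.
Qed.

Lemma walsh_dual_unique f a (s : bool) (c : 'F_p) : bent f ->
  walsh f a = (-1) ^+ s * (q * chi c) -> (a \notin Bplus f) = s /\ dual f a = c.
Proof. by move=> /(walsh_dual a)-> /signed_chi_inj. Qed.

Lemma Bminus_setC f : bent f -> Bminus f = ~: Bplus f.
Proof.
move=> f_bent; apply/setP => a.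
rewrite [in RHS]inE -[RHS]/(a \notin Bplus f) inE mu_even mul1r -/(chi _).
rewrite walsh_dual //; set s := a \notin _.
rewrite -[X in _ == X]mulN1r -[X in _ == X * _](expr1 (-1)).
apply/eqP/idP => [/(@signed_chi_inj s true)[]//|-> //].
Qed.

(** Substitute [b *: x] for [x]: both [f (b *: x)] and [dot (t *: a) (b *: x)] acquire the factor
    [t * b], which a Galois automorphism absorbs. *)
Lemma walsh_scale f a (t b : 'F_p) h :
  t != 0 -> b != 0 -> t * b = b ^+ h ->
  (forall c x, c != 0 -> f (c *: x) = c ^+ h * f x) ->
  exists sigma : {rmorphism algC -> algC},
    (forall c, sigma (chi c) = chi (t * b * c)) /\
    walsh f (t *: a) = sigma (walsh f a).
Proof.
move=> t_neq0 b_neq0 tbE f_hom.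
have [|sigma sigmaE] := Galois_chi p_prime p_odd (_ : t * b != 0).
  by rewrite mulf_neq0.
exists sigma; split=> //; rewrite /walsh.
rewrite (reindex_inj (scalerI b_neq0)) rmorph_sum; apply: eq_bigr => x _.
rewrite -[X in sigma X]/(chi _) sigmaE -[LHS]/(chi _); congr chi.
by rewrite f_hom // dotZl dotZr -tbE mulrBr mulrA.
Qed.

(** The automorphism of [walsh_scale] fixes the sign and [q], an integer because [n] is even, so it
    acts on the exponent alone. *)
Lemma dual_scale f a (t b : 'F_p) h : bent f ->
  t != 0 -> b != 0 -> t * b = b ^+ h ->
  (forall c x, c != 0 -> f (c *: x) = c ^+ h * f x) ->
  dual f (t *: a) = t * b * dual f a.
Proof.
move=> f_bent t_neq0 b_neq0 tbE f_hom.
have [sigma [sigmaE walshE]] := walsh_scale a t_neq0 b_neq0 tbE f_hom.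
suff: walsh f (t *: a) =
      (-1) ^+ (a \notin Bplus f) * (q * chi (t * b * dual f a)).
  by move=> /(walsh_dual_unique f_bent)[].
rewrite walshE walsh_dual // !rmorphM /= rmorph_sign sigmaE.
by rewrite sqrt_pnE rmorphXn /= rmorph_nat.
Qed.

Lemma walsh_inversion f x :
  \sum_a walsh f a * chi (dot a x) = (p ^ n)%:R * chi (f x).
Proof.
rewrite -(Fourier_inversion p_prime p_odd (fun y => chi (f y))).
apply: eq_bigr => a _; congr (_ * _); apply: eq_bigr => y _.
by rewrite -chiD.
Qed.

Lemma sum_sign_dual f x : bent f ->
  \sum_a (-1) ^+ (a \notin Bplus f) * chi (dual f a + dot a x) = q * chi (f x).
Proof.
move=> f_bent; apply: (mulfI sqrt_pn_neq0).
rewrite mulrA -expr2 sqrt_pn_sqr -walsh_inversion mulr_sumr.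
apply: eq_bigr => a _; rewrite walsh_dual // chiD //.
by rewrite mulrCA !mulrA.
Qed.

(** If [a != b], all coefficients of the resulting integer relation between the values of [chi] are
    equal; but the one at [a] is odd, and the one at any third point is even. *)
Lemma chi_half_sum_eq (N : 'F_p -> int) (m m' : int) (a b : 'F_p) :
  odd `|m|%N ->
  2 * (\sum_(c : 'F_p) (N c)%:~R * chi c) = m%:~R * chi a + m'%:~R * chi b ->
  a = b.
Proof.
move=> m_odd E; apply/eqP; apply: contraT => ab.
pose M (c : 'F_p) : int := 2 * N c - m * (c == a)%:Z - m' * (c == b)%:Z.
have M_sum : \sum_(c : 'F_p) (M c)%:~R * chi c = 0.
  have pick_sum (d : 'F_p) : \sum_(c : 'F_p) ((c == d)%:Z)%:~R * chi c = chi d.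
    rewrite (bigD1 d) //= eqxx mul1r big1 ?addr0 // => c /negPf->.
    by rewrite mul0r.
  transitivity (\sum_(c : 'F_p) (2 * ((N c)%:~R * chi c) -
      (m%:~R * (((c == a)%:Z)%:~R * chi c) + m'%:~R * (((c == b)%:Z)%:~R * chi c)))).
    apply: eq_bigr => c _; rewrite /M !(rmorphB, rmorphM, rmorphD) /=.
    ring.
  by rewrite sumrB -!mulr_sumr big_split /= -!mulr_sumr !pick_sum E subrr.
have M_const := chi_sum_eq0 p_prime p_odd M_sum.
have [c /norP[ca cb]] : exists c : 'F_p, ~~ ((c == a) || (c == b)).
  apply/existsP; apply: contraT; rewrite negb_exists => /forallP H.
  have : (#|'F_p| <= #|[set a; b]|)%N.
    by apply: subset_leq_card; apply/subsetP => c _; move: (H c); rewrite negbK !inE.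
  rewrite card_Fp // cards2 ab /=; move: p_odd (prime_gt1 p_prime).
  by case: p => [|[|[|]]].
have := M_const a c; rewrite /M eqxx (negPf ab) (negPf ca) (negPf cb) /=.
move: m_odd; clear; lia.
Qed.

(** The signed sum of [sum_sign_dual] and the unsigned one, which is the Walsh transform of [dual f]
    at [- x], add up to twice a sum over [Bplus f]. Parity then identifies the two exponents. *)
Lemma dual_dual f x : bent f -> bent (dual f) -> dual (dual f) (- x) = f x.
Proof.
move=> f_bent g_bent; symmetry.
pose N (c : 'F_p) : int := #|[set a in Bplus f | dual f a + dot a x == c]|%:Z.
pose s := - x \notin Bplus (dual f).
apply: (@chi_half_sum_eq N (p ^ n./2)%:Z ((-1) ^+ s * (p ^ n./2)%:Z)).
  by rewrite absz_nat oddX p_odd orbT.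
rewrite intrM rmorph_sign -[(p ^ n./2)%:Z%:~R]/((p ^ n./2)%:R) natrX -sqrt_pnE. 
rewrite -(sum_sign_dual x f_bent) -mulrA.
rewrite -(walsh_dual _ g_bent) /walsh -big_split.
have NE : \sum_(c : 'F_p) (N c)%:~R * chi c =
          \sum_(a in Bplus f) chi (dual f a + dot a x).
  rewrite (partition_big (fun a => dual f a + dot a x) predT) //=.
  apply: eq_bigr => c _; rewrite /N cardsE.
  rewrite (eq_bigr (fun=> chi c)) => [|a /andP[_ /eqP->]//].
  by rewrite sumr_const mulr_natl.
rewrite NE mulr_sumr [LHS]big_mkcond; apply: eq_bigr => a _.
rewrite -/(chi _) dotNl opprK [dot x a]dotC.
case: (a \in _) => /=; first by rewrite expr0 mul1r mulr_natl mulr2n.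
by rewrite expr1 mulN1r addNr.
Qed.

(** As [p] is odd, nonzero vectors pair off under negation; comparing [enum_rank] picks one vector
    from each pair. *)
Lemma sum_even (F : 'rV['F_p]_n -> algC) : (forall x, F (- x) = F x) ->
  \sum_(x | x != 0) F x =
  2 * \sum_(x | (x != 0) && (enum_rank x < enum_rank (- x))%N) F x.
Proof.
move=> F_even.
rewrite (bigID (fun x => (enum_rank x < enum_rank (- x))%N)) mulr_natl mulr2n /=.
congr (_ + _); rewrite [RHS](reindex_inj oppr_inj).
apply: eq_big => [x | x _]; last by rewrite F_even.
rewrite oppr_eq0 opprK -leqNgt leq_eqVlt.
case: eqVneq => //= x_neq0; case: (enum_rank (- x) =P enum_rank x :> nat) => //= E.
case/eqP: x_neq0; have /enum_rank_inj xE : enum_rank (- x) = enum_rank x.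
  exact: val_inj.
apply/rowP => i; move/rowP/(_ i)/eqP: xE; rewrite !mxE.
rewrite -subr_eq0 -opprD oppr_eq0 -mulr2n -mulr_natr mulf_eq0 => /orP[/eqP//|].
rewrite -(dvdn_pcharf (pchar_Fp p_prime)) dvdn_prime2 //.
by move=> /eqP/(congr1 odd); rewrite p_odd.
Qed.

(** By evenness the Walsh value at 0 is 1 plus twice a sum of character values, so [chi_half_sum_eq]
    applies with the odd coefficient -1. *)
Lemma dual_at0 f : bent f -> (forall x, f (- x) = f x) -> f 0 = 0 ->
  dual f 0 = 0.
Proof.
move=> f_bent f_even f0; symmetry.
pose H x := (x != 0) && (enum_rank x < enum_rank (- x))%N.
pose N (c : 'F_p) : int := #|[set x | H x && (f x == c)]|%:Z.
pose s := 0 \notin Bplus f.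
apply: (@chi_half_sum_eq N (-1) ((-1) ^+ s * (p ^ n./2)%:Z)) => //.
rewrite intrM rmorph_sign -[(p ^ n./2)%:Z%:~R]/((p ^ n./2)%:R) natrX -sqrt_pnE. 
rewrite -mulrA -(walsh_dual _ f_bent) /walsh.
have NE : \sum_(c : 'F_p) (N c)%:~R * chi c = \sum_(x | H x) chi (f x).
  rewrite (partition_big f predT) //=.
  apply: eq_bigr => c _; rewrite /N cardsE.
  rewrite (eq_bigr (fun=> chi c)) => [|a /andP[_ /eqP->]//].
  by rewrite sumr_const mulr_natl.
rewrite NE -(sum_even (F := fun x => chi (f x))) => [|x]; last by rewrite f_even.
transitivity (- chi (0 : 'F_p) + \sum_x chi (f x)).
  by rewrite [in RHS](bigD1 0) //= f0 addKr.
rewrite rmorphN1 mulN1r; congr (_ + _); apply: eq_bigr => x _.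
by rewrite dot0l subr0.
Qed.

End BentFunctions.

(** * Character sums over level sets *)

(* That is, every [t] is an (h - 1)-st power; this encodes gcd(h - 1, p - 1) = 1. *)
Definition full_degree (p h : nat) : Prop :=
  forall t : 'F_p, t != 0 -> exists2 u : 'F_p, u != 0 & t * u = u ^+ h.

Definition homogeneous (p n h : nat) (f : 'rV['F_p]_n -> 'F_p) : Prop :=
  forall (c : 'F_p) (x : 'rV['F_p]_n), c != 0 -> f (c *: x) = c ^+ h * f x.

(** Here [U] stands for B_+(f) and [W] for B_+(g), with [g] the dual of [f]. The fields are
    invariant under exchanging the two sides, so each consequence is proved once and used in both
    directions. *)
Record dual_pair (p n : nat) (f g : 'rV['F_p]_n -> 'F_p)
    (U W : {vspace 'rV['F_p]_n}) (h h' : nat) : Prop := DualPair {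
  walsh_left : forall a,
    walsh f a = (-1) ^+ (a \notin U) * (sqrt_pn p n * chi (g a));
  walsh_right : forall x,
    walsh g x = (-1) ^+ (x \notin W) * (sqrt_pn p n * chi (f x));
  left0 : f 0 = 0;
  right0 : g 0 = 0;
  left_homogeneous : homogeneous h f;
  right_homogeneous : homogeneous h' g;
  left_full : full_degree p h;
  right_full : full_degree p h';
  left_degree_even : ~~ odd h;
  right_degree_even : ~~ odd h'
}.

Lemma dual_pair_sym p n f g U W h h' :
  @dual_pair p n f g U W h h' -> dual_pair g f W U h' h.
Proof. by case. Qed.

Section DualPair.

Variables (p n : nat) (p_prime : prime p) (p_odd : odd p) (n_even : ~~ odd n).
Implicit Types (f g : 'rV['F_p]_n -> 'F_p) (a x : 'rV['F_p]_n).
Implicit Types (U W : {vspace 'rV['F_p]_n}).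

Let p_gt0 : (0 < p)%N := prime_gt0 p_prime.
Local Notation q := (sqrt_pn p n).

Lemma homogeneousN f h x : homogeneous h f -> ~~ odd h -> f (- x) = f x.
Proof.
move=> f_hom h_even; rewrite -scaleN1r f_hom ?oppr_eq0 ?oner_eq0 //.
by rewrite -signr_odd (negPf h_even) mul1r.
Qed.

(** The flag [b] selects [W] or its complement. The unsigned sum over all [x] is a Walsh value of
    [f], the signed one is the Fourier inverse of the transform of [g]; half their sum or difference
    isolates one part. *)
Lemma part_sum f g U W h h' b a : dual_pair f g U W h h' ->
  \sum_(x | (x \in W) == b) chi (f x + dot a x) =
  (-1) ^+ (~~ b) * (q * ((a \in U) == b)%:R * chi (g a)).
Proof.
move=> fg; have walshN : \sum_x chi (f x + dot a x) =
    (-1) ^+ (a \notin U) * (q * chi (g a)).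
  rewrite -(homogeneousN a (right_homogeneous fg) (right_degree_even fg)).
  rewrite -memvN -(walsh_left fg); apply: eq_bigr => x _.
  by rewrite dotNl opprK.
have sum_sign : \sum_x (-1) ^+ (x \notin W) * chi (f x + dot a x) =
    q * chi (g a).
  apply: (mulfI (sqrt_pn_neq0 p_prime n_even)).
  rewrite mulrA -expr2 sqrt_pn_sqr // -walsh_inversion // mulr_sumr.
  apply: eq_bigr => x _; rewrite (walsh_right fg) chiD // dotC.
  by rewrite mulrCA !mulrA.
have two_neq0 : 2 != 0 :> algC by rewrite pnatr_eq0.
apply: (mulfI two_neq0).
transitivity (\sum_x chi (f x + dot a x)
   + (-1) ^+ (~~ b) * \sum_x (-1) ^+ (x \notin W) * chi (f x + dot a x)).
  rewrite mulr_sumr -big_split [in LHS]big_mkcond mulr_sumr.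
  apply: eq_bigr => x _ /=.
  by case: (x \in W); case: b => /=; rewrite ?expr1 ?expr0; ring.
rewrite walshN sum_sign.
by case: (a \in U); case: b => /=; rewrite ?expr1 ?expr0; ring.
Qed.

(** For [x] orthogonal to [U], the sum over [U] given by the mirrored [part_sum] is the same at [x]
    as at 0, where it equals [q]; so it does not vanish and [chi (f x)] is 1. *)
Lemma orth_sub f g U W h h' x : dual_pair f g U W h h' ->
  x \in orth_compl (vset U) -> x \in W /\ f x = 0.
Proof.
move=> /dual_pair_sym gf /orth_complP orth.
have sumE := part_sum true _ gf.
have : q * ((x \in W) == true)%:R * chi (f x) = q.
  rewrite -[LHS]mul1r -(sumE x) -[RHS]mulr1 -(chi0 p) -{1}(right0 gf).
  rewrite -[q in RHS]mulr1 -[1](_ : ((0 \in W) == true)%:R = 1); last first.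
    by rewrite mem0v.
  rewrite -[RHS]mul1r -(sumE 0); apply: eq_bigr => a; rewrite eqb_id => aU.
  by rewrite orth // dot0l.
case: (x \in W) => /=; last first.
  by rewrite mulr0 mul0r => /eqP; rewrite eq_sym (negPf (sqrt_pn_neq0 p_prime n_even)).
rewrite mulr1 -[RHS]mulr1 => /(mulfI (sqrt_pn_neq0 p_prime n_even))/eqP.
by rewrite chi_eq1 // => /eqP.
Qed.

Lemma memvZ_eq U (c : 'F_p) a : c != 0 -> (c *: a \in U) = (a \in U).
Proof.
move=> c_neq0; apply/idP/idP => [caU|]; last exact: memvZ.
by rewrite -[a](scalerK c_neq0) memvZ.
Qed.

(** Apply the automorphism multiplying exponents by [y] to [part_sum] at [y^-1 *: a]; it fixes
    [q]. *)
Lemma part_sum_scaled f g U W h h' b a (y : 'F_p) : dual_pair f g U W h h' ->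
  y != 0 ->
  \sum_(x | (x \in W) == b) chi (y * f x + dot a x) =
  (-1) ^+ (~~ b) * (q * ((a \in U) == b)%:R * chi (y * g (y^-1 *: a))).
Proof.
move=> fg y_neq0; have [sigma sigmaE] := Galois_chi p_prime p_odd y_neq0.
have := congr1 sigma (part_sum b (y^-1 *: a) fg).
rewrite rmorph_sum !rmorphM rmorph_sign memvZ_eq ?invr_eq0 // rmorph_nat.
rewrite sigmaE sqrt_pnE // rmorphXn /= rmorph_nat -(sqrt_pnE p n_even) => <-.
apply: eq_bigr => x _; rewrite sigmaE; congr chi.
by rewrite mulrDr dotZl mulVKf.
Qed.

Definition part_char W b a : algC := \sum_(x | (x \in W) == b) chi (dot a x).

Lemma part_charE W b a : part_char W b a =
  let s := (p ^ \dim W)%:R * (a \in orth_compl (vset W))%:R in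
  if b then s else (p ^ n)%:R * (a == 0)%:R - s.
Proof.
have sumW : part_char W true a =
    (p ^ \dim W)%:R * (a \in orth_compl (vset W))%:R.
  by rewrite -sum_chi_vspace //; apply: eq_bigl => x; rewrite eqb_id.
case: b => //=; rewrite -sumW -sum_chi_dot //.
rewrite [X in X - _](bigID (fun x => (x \in W) == true)) /= addrAC subrr add0r.
by apply: eq_bigl => x; case: (x \in W).
Qed.

Definition level_sum f W b (J : pred 'F_p) a : algC :=
  \sum_(x | ((x \in W) == b) && J (f x)) chi (dot a x).

(** Summing [chi (y * (f x - j))] over [y] detects [f x = j]; the term [y = 0] is the character sum
    of the whole part. *)
Lemma level_sumE f g U W h h' b (j : 'F_p) a : dual_pair f g U W h h' ->
  p%:R * level_sum f W b (pred1 j) a = part_char W b a +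
   (-1) ^+ (~~ b) * (q * ((a \in U) == b)%:R *
     \sum_(y : 'F_p | y != 0) chi (- (y * j) + y * g (y^-1 *: a))).
Proof.
move=> fg.
transitivity (\sum_(y : 'F_p) chi (- (y * j)) *
               \sum_(x | (x \in W) == b) chi (y * f x + dot a x)).
  rewrite /level_sum mulr_sumr big_mkcondr /=.
  under [RHS]eq_bigr do rewrite mulr_sumr.
  rewrite [RHS]exchange_big /=; apply: eq_bigr => x _.
  transitivity (chi (dot a x) * \sum_(y : 'F_p) chi (y * (f x - j))).
    rewrite sum_chi // subr_eq0; case: eqP => _; last by rewrite !mulr0.
    by rewrite mulr1 mulrC.
  rewrite mulr_sumr; apply: eq_bigr => y _.
  by rewrite -!chiD //; congr chi; ring.
rewrite (bigD1 0) //= mul0r oppr0 chi0 mul1r; congr (_ + _).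
  by apply: eq_bigr => x _; rewrite mul0r add0r.
rewrite !mulr_sumr; apply: eq_bigr => y y_neq0.
by rewrite (part_sum_scaled b a fg) // chiD //; ring.
Qed.

(** Replace [y] by [u * z] in [level_sumE] at [a']: by [t * u = u ^+ h'] the factor [t] cancels
    against the powers of [u], and [j] turns into [u * j]. *)
Lemma level_sum_scale f g U W h h' b (j t u : 'F_p) a a' :
    dual_pair f g U W h h' ->
    u != 0 -> t * u = u ^+ h' -> g a' = t * g a ->
    (a == 0) = (a' == 0) -> (a \in U) = (a' \in U) ->
    (a \in orth_compl (vset W)) = (a' \in orth_compl (vset W)) ->
  level_sum f W b (pred1 j) a' = level_sum f W b (pred1 (u * j)) a.
Proof.
move=> fg u_neq0 tuE gE a0E aUE aWE.
have p_neq0 : p%:R != 0 :> algC by rewrite pnatr_eq0 -lt0n.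
apply: (mulfI p_neq0); rewrite !(level_sumE b _ _ fg) !part_charE a0E aUE aWE.
congr (_ + _ * (_ * _)).
rewrite (reindex_inj (mulfI u_neq0)) /=.
apply: eq_big => [z | z]; first by rewrite mulf_eq0 (negPf u_neq0).
rewrite mulf_eq0 negb_or u_neq0 /= => z_neq0; congr chi; congr (- _ + _).
  by rewrite mulrCA mulrA.
rewrite !(right_homogeneous fg) ?invr_eq0 ?mulf_neq0 // gE.
rewrite invfM exprMn !exprVn -tuE.
have t_neq0 : t != 0.
  apply: contraTneq (expf_neq0 h' u_neq0) => t0.
  by rewrite -tuE t0 mul0r eqxx.
move: (z ^- h') => w; field; rewrite ?t_neq0 ?u_neq0 //.
Qed.

Lemma level_sum_invariant f g U W h h' b (J : pred 'F_p) (t u : 'F_p) a a' :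
    dual_pair f g U W h h' ->
    u != 0 -> t * u = u ^+ h' -> g a' = t * g a ->
    (a == 0) = (a' == 0) -> (a \in U) = (a' \in U) ->
    (a \in orth_compl (vset W)) = (a' \in orth_compl (vset W)) ->
    (forall j, J (u * j) = J j) ->
  level_sum f W b J a' = level_sum f W b J a.
Proof.
move=> fg u_neq0 tuE gE a0E aUE aWE JE.
have expand c : level_sum f W b J c =
    \sum_(j | J j) level_sum f W b (pred1 j) c.
  rewrite /level_sum (partition_big f J) => [|x /andP[]//].
  apply: eq_bigr => j Jj; apply: eq_bigl => x /=.
  by rewrite -andbA; case: (f x =P j) => [->|_]; rewrite ?Jj ?andbF ?andbT.
rewrite !expand [RHS](reindex_inj (mulfI u_neq0)).
apply: eq_big => [j | j _]; first by rewrite JE.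
exact: level_sum_scale fg u_neq0 tuE gE a0E aUE aWE.
Qed.

End DualPair.

(** * Schemes from fusions of level sets *)

(* Instances: the classes {0}, SQ, NSQ (with m = 3) give U4, and {0}, F_p^*
   (with m = 2) give U5. *)
Record fusion (p m : nat) (kappa : 'F_p -> nat) : Prop := Fusion {
  fusion_lt : forall c, (kappa c < m)%N;
  fusion_surj : forall k, (k < m)%N -> exists c, kappa c = k;
  fusion_eq0 : forall c, (kappa c == 0) = (c == 0);
  fusion_scale : forall h c c', full_degree p h -> kappa c = kappa c' ->
    exists t u : 'F_p, [/\ u != 0, t * u = u ^+ h, c' = t * c
                         & forall j, kappa (u * j) = kappa j]
}.

Section FusionScheme.

Variables (p n : nat) (p_prime : prime p) (p_odd : odd p) (n_even : ~~ odd n).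
Variables (m : nat) (kappa : 'F_p -> nat) (kappa_fusion : fusion m kappa).
Implicit Types (f g : 'rV['F_p]_n -> 'F_p) (a x : 'rV['F_p]_n).
Implicit Types (U W : {vspace 'rV['F_p]_n}).

Let p_gt0 : (0 < p)%N := prime_gt0 p_prime.
Local Notation q := (sqrt_pn p n).

(* The labels number the blocks in the order in which U4 and U5 list them. *)
Definition label f U W x : nat :=
  if x == 0 then 0%N else if x \in orth_compl (vset U) then 1%N
  else (2 + ((x \notin W) * m + kappa (f x)))%N.

Lemma label_le f U W x : (label f U W x <= (2 * m).+1)%N.
Proof.
rewrite /label; case: ifP => // _; case: ifP => // _.
by have := fusion_lt kappa_fusion (f x); case: (x \notin W) => /=; lia.
Qed.

Lemma label_eq0 f U W x : (label f U W x == 0%N) = (x == 0).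
Proof. by rewrite /label; case: (x == 0) => //; case: ifP. Qed.

Lemma kappa0 : kappa 0 = 0%N.
Proof. by apply/eqP; rewrite (fusion_eq0 kappa_fusion). Qed.

Lemma orth0 U : 0 \in orth_compl (vset U).
Proof. by apply/orth_complP => y _; exact: dot0l. Qed.

(** Labels 0 and 1 do not record [W] and [f], but by [orth_sub] both are determined there. From 2
    on, [kappa < m] makes the encoding injective. *)
Lemma label_eqP f g U W h h' x y : dual_pair f g U W h h' ->
  label f U W x = label f U W y ->
  [/\ (x == 0) = (y == 0),
      (x \in orth_compl (vset U)) = (y \in orth_compl (vset U)),
      (x \in W) = (y \in W)
    & kappa (f x) = kappa (f y)].
Proof.
move=> fg; have orthE z := orth_sub p_prime p_odd n_even fg (x := z).
rewrite /label; case: (eqVneq x 0) => [-> | x_neq0].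
  case: (eqVneq y 0) => [-> // | y_neq0]; by case: ifP.
case: (eqVneq y 0) => [-> | y_neq0]; first by case: ifP.
case: (boolP (x \in orth_compl _)) => [/orthE[-> ->] | xU].
  by case: (boolP (y \in orth_compl _)) => [/orthE[-> ->] | yU].
case: (boolP (y \in orth_compl _)) => [/orthE[-> ->] | yU] //.
have := fusion_lt kappa_fusion (f x); have := fusion_lt kappa_fusion (f y).
by case: (x \in W); case: (y \in W) => /= ? ? ?; split=> //; lia.
Qed.

Definition orth_sum U a : algC := \sum_(x in orth_compl (vset U)) chi (dot a x).

(** Labels [k.+2] with [k < m] lie inside [W], the others outside. By [orth_sub] the orthogonal of
    [U] is removed only from the zero class inside [W]. *)
Lemma label_sumE f g U W h h' i a : dual_pair f g U W h h' ->
  label_sum (label f U W) i a =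
  match i with
  | 0 => 1
  | 1 => orth_sum U a - 1
  | k.+2 =>
    let b := (k < m)%N in let c := (if b then k else k - m)%N in
    level_sum f W b (fun j => kappa j == c) a
      - (b && (c == 0%N))%:R * orth_sum U a
  end.
Proof.
move=> fg; have orthE z := orth_sub p_prime p_odd n_even fg (x := z).
rewrite /label_sum; case: i => [|[|k]].
- rewrite (big_pred1 0) => [|x]; last exact: label_eq0.
  by rewrite dot0r chi0.
- rewrite /orth_sum [in RHS](bigD1 0) ?orth0 // dot0r chi0 addrAC subrr add0r.
  apply: eq_bigl => x; rewrite /label; case: (x == 0); rewrite ?andbF ?andbT //.
  by case: ifP.
set b := (k < m)%N; set c := if b then k else (k - m)%N => /=.
have c_lt x : ((x \notin W) * m + kappa (f x))%N = k ->
    ((x \in W) == b) && (kappa (f x) == c).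
  have := fusion_lt kappa_fusion (f x); rewrite /c /b.
  by case: (x \in W) => /= ? E; case: ltnP; rewrite /=; lia.
have labelE x : (label f U W x == k.+2) =
    (((x \in W) == b) && (kappa (f x) == c)) && (x \notin orth_compl (vset U)).
  rewrite /label; case: (eqVneq x 0) => [-> | x_neq0]; first by rewrite orth0 andbF.
  case: (boolP (x \in orth_compl _)) => xU; rewrite ?andbF ?andbT //.
  rewrite !eqSS; apply/eqP/idP => [/c_lt // | /andP[/eqP xW /eqP ->]].
  rewrite /c -xW; move: xW; rewrite /b.
  by case: (x \in W) => /=; case: ltnP => //=; lia.
rewrite (eq_bigl _ _ labelE) /level_sum.
rewrite [X in _ = X - _](bigID (fun x => x \in orth_compl (vset U))) /= addrAC.
rewrite [X in X + _](_ : _ = 0) ?add0r //; apply/eqP; rewrite subr_eq0; apply/eqP.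
rewrite /orth_sum mulr_sumr big_mkcond [RHS]big_mkcond /=.
apply: eq_bigr => x _; case: (boolP (x \in orth_compl _)) => [/orthE[-> ->]|].
  rewrite kappa0 [(0 == c)%N]eq_sym andbT; move: (c == 0%N) => c0.
  by rewrite /b; case: (k < m)%N; case: c0; rewrite /= ?mul1r ?mul0r.
by rewrite andbF.
Qed.

(** The data shared by equal labels on the dual side are exactly those on which the level sums, and
    the sum over the orthogonal of [U], depend. *)
Lemma label_sum_invariant f g U W h h' i a a' : dual_pair f g U W h h' ->
  label g W U a = label g W U a' ->
  label_sum (label f U W) i a = label_sum (label f U W) i a'.
Proof.
move=> fg label_aa'.
have [a0E aWE aUE kE] := label_eqP (dual_pair_sym fg) label_aa'.
have orthE : orth_sum U a = orth_sum U a'.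
  by rewrite /orth_sum !sum_chi_orth // aUE.
rewrite !(label_sumE _ _ fg); case: i => [|[|k]] //; rewrite /= ?orthE //.
congr (_ - _).
have [t [u [u_neq0 tuE gE JE]]] := fusion_scale kappa_fusion (right_full fg) kE.
by symmetry; apply: (level_sum_invariant _ _ _ _ fg u_neq0 tuE gE) => // j; rewrite JE.
Qed.

(** * Sizes of the blocks and the resulting schemes *)

Section Nonempty.

Variables (f g : 'rV['F_p]_n -> 'F_p) (U W : {vspace 'rV['F_p]_n}).
Variables (h h' r : nat) (fg : dual_pair f g U W h h').
Variables (dimU : \dim U = r) (dimW : \dim W = r).
Variables (r_gt : (n./2 < r)%N) (r_lt : (r < n)%N).

Let level b c : {set 'rV['F_p]_n} := [set x | ((x \in W) == b) && (f x == c)].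

Lemma card_level b (c : 'F_p) : p%:R * #|level b c|%:R =
  if b then (p ^ r)%:R + q * (p%:R * (c == 0)%:R - 1)
  else (p ^ n)%:R - (p ^ r)%:R :> algC.
Proof.
have -> : #|level b c|%:R = level_sum f W b (pred1 c) 0.
  rewrite /level_sum -sum1_card natr_sum; apply: eq_big => x; first by rewrite inE.
  by rewrite dot0l chi0.
rewrite (level_sumE p_prime p_odd n_even b c 0 fg) part_charE // orth0 eqxx.
rewrite mem0v dimW; case: b => /=; last by rewrite !mulr1 mulr0 mul0r mulr0 addr0.
rewrite expr0 mul1r !mulr1; congr (_ + _ * _).
rewrite -(oppr_eq0 c) -sum_chi_neq0 //; apply: eq_bigr => y _.
by rewrite scaler0 (right0 fg) mulr0 addr0 mulrN.
Qed.

Let q_lt : (p ^ n./2 < p ^ r)%N.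
Proof. by rewrite ltn_exp2l // prime_gt1. Qed.

(** By [card_level], [p] times the size is at least [p ^ r - q] inside [W] and equals
    [p ^ n - p ^ r] outside; both are positive. *)
Lemma level_nonempty b c : exists x, x \in level b c.
Proof.
apply/existsP; apply: contraT => /existsPn none.
have level0 : #|level b c| = 0%N by apply: eq_card0 => x; apply/negbTE.
have := card_level b c; rewrite level0 mulr0; case: b none level0 => _ _ /eqP.
  rewrite mulrBr mulr1 addrA eq_sym subr_eq0 sqrt_pnE // -natrX -!natrM -natrD eqr_nat.
  by move/eqP; move: q_lt; lia.
rewrite eq_sym subr_eq0 eqr_nat => /eqP E.
have : (p ^ r < p ^ n)%N by rewrite ltn_exp2l // prime_gt1.
by rewrite E ltnn.
Qed.

Lemma card_orth : #|orth_compl (vset U)| = (p ^ (n - r))%N.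
Proof.
have := sum_chi_orth p_prime p_odd U 0; rewrite mem0v mulr1 dimU.
under eq_bigr do rewrite dot0l chi0.
have -> : (p ^ n)%N = (p ^ (n - r) * p ^ r)%N by rewrite -expnD subnK // ltnW.
rewrite sumr_const natrM mulfK => [/eqP|]; first by rewrite eqr_nat => /eqP.
by rewrite pnatr_eq0 expn_eq0 negb_and -lt0n p_gt0.
Qed.

Lemma label_surj i : (i <= (2 * m).+1)%N -> exists x, label f U W x = i.
Proof.
move=> i_le; have orthE z := orth_sub p_prime p_odd n_even fg (x := z).
have p_gt1 := prime_gt1 p_prime.
have label_level b x k : f x = k -> (x \in W) = b ->
    x \notin orth_compl (vset U) -> label f U W x = (2 + (~~ b * m + kappa k))%N.
  move=> fx xW xU; rewrite /label (negPf xU) fx xW ifN //.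
  by apply: contraNneq xU => ->; exact: orth0.
case: i i_le => [|[|k]] k_le.
- by exists 0; rewrite /label eqxx.
- have : (1 < #|orth_compl (vset U)|)%N.
    by rewrite card_orth -[1%N](expn0 p) ltn_exp2l // subn_gt0.
  rewrite (cardD1 0) orth0 ltnS => /card_gt0P[x].
  by rewrite !inE => /andP[x_neq0 xU]; exists x; rewrite /label (negPf x_neq0) inE xU.
have [k_lt | k_ge] := ltnP k m; last first.
  have k_lt : (k - m < m)%N by lia.
  have [c cE] := fusion_surj kappa_fusion k_lt.
  have [x] := level_nonempty false c; rewrite inE => /andP[/eqP xW /eqP fx].
  exists x; rewrite (label_level _ _ _ fx xW) ?cE /=; first by lia.
  by apply/negP => /orthE[]; rewrite xW.
have [c cE] := fusion_surj kappa_fusion k_lt.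
have [c0 | c_neq0] := eqVneq c 0; last first.
  have [x] := level_nonempty true c; rewrite inE => /andP[/eqP xW /eqP fx].
  exists x; rewrite (label_level _ _ _ fx xW) ?cE //=.
  by apply/negP => /orthE[_]; rewrite fx => /eqP; rewrite (negPf c_neq0).
suff [x] : exists x, x \in level true 0 :\: orth_compl (vset U).
  rewrite in_setD [x \in level _ _]inE => /and3P[xU /eqP xW /eqP fx].
  by exists x; rewrite (label_level _ _ _ fx xW) // -c0 cE.
apply/existsP; apply: contraT => /existsPn none.
have : (#|level true 0%R| <= #|orth_compl (vset U)|)%N.
  rewrite subset_leq_card // -setD_eq0; apply/eqP/setP => x; rewrite in_set0.
  exact/negbTE.
rewrite card_orth => level_le.
have := card_level true 0; rewrite eqxx mulr1 mulrBr mulr1 addrA => /eqP.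
rewrite eq_sym subr_eq sqrt_pnE // -natrX -!natrM -!natrD eqr_nat => /eqP levelE.
(* As [r] is at least [n./2 + 1], [p] times the size of the orthogonal is at most [q], while [p]
   times the size of the zero level is [p ^ r + q * (p - 1)], which exceeds [q]. *)
have pow_le : (p * p ^ (n - r) <= p ^ n./2)%N.
  rewrite -expnS leq_exp2l //; move: r_gt r_lt n_even; lia.
move: q_lt level_le levelE pow_le p_gt1; nia.
Qed.

(** The labelling built from [g] with [U] and [W] exchanged serves as the dual partition in
    [label_scheme]. *)
Lemma fusion_scheme d (T : d.+1.-tuple {set 'rV['F_p]_n}) :
    d = (2 * m).+1 ->
    (forall i : 'I_d.+1, tnth T i = [set x | label f U W x == i]) ->
  induces_symmetric_scheme T.
Proof.
move=> dE TE.
apply: (label_scheme p_prime p_odd (l := label f U W) (l' := label g W U)) => //.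
- by move=> x; rewrite dE label_le.
- by move=> x; rewrite dE label_le.
- by move=> i; apply: label_surj; rewrite -dE -ltnS.
- exact: label_eq0.
- move=> x; rewrite /label oppr_eq0 memvN.
  rewrite (homogeneousN _ (left_homogeneous fg) (left_degree_even fg)).
  suff -> : (- x \in orth_compl (vset U)) = (x \in orth_compl (vset U)) by [].
  apply/orth_complP/orth_complP => orth y yU.
    by rewrite -[x]opprK dotNl orth // oppr0.
  by rewrite dotNl orth // oppr0.
- by move=> i a a'; exact: (label_sum_invariant _ fg).
by move=> i x y; exact: (label_sum_invariant _ (dual_pair_sym fg)).
Qed.

End Nonempty.

End FusionScheme.

(** * Square classes and homogeneity of the dual *)

Section PrimeField.

Variables (p : nat) (p_prime : prime p) (p_odd : odd p).

Let p_gt0 : (0 < p)%N := prime_gt0 p_prime.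
Let p_gt2 : (2 < p)%N := odd_prime_gt2 p_odd p_prime.

Lemma Fp_fermat (t : 'F_p) : t != 0 -> t ^+ (p - 1) = 1.
Proof.
move=> t_neq0; apply: (mulfI t_neq0); rewrite mulr1 -exprS subn1 prednK //.
by rewrite -[RHS]expf_card card_Fp.
Qed.

Lemma Fp_prim_root : exists z : 'F_p, (p - 1).-primitive_root z.
Proof.
have p1_gt0 : (0 < p - 1)%N by rewrite subn_gt0 prime_gt1.
have /hasP[z _ prim_z] : has (p - 1).-primitive_root (enum [pred t : 'F_p | t != 0]).
  apply: has_prim_root => //; last 2 first.
  - exact: enum_uniq.
  - by rewrite -cardE cardC1 card_Fp // subn1.
  by apply/allP => t; rewrite mem_enum unity_rootE => t_neq0; rewrite Fp_fermat.
by exists z.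
Qed.

Lemma SQ_exp (z : 'F_p) i : (p - 1).-primitive_root z ->
  (z ^+ i \in SQ p) = ~~ odd i.
Proof.
move=> prim_z; have z_neq0 : z != 0.
  by rewrite (prim_root_eq0 prim_z) subn_eq0 -ltnNge prime_gt1.
rewrite inE expf_neq0 //=; apply/existsP/idP => [[y /eqP zy]|i_even]; last first.
  by exists (z ^+ i./2); rewrite -exprM muln2 even_halfK.
have y_neq0 : y != 0.
  apply: contraTneq (expf_neq0 i z_neq0) => y0.
  by rewrite zy y0 expr0n eqxx.
have [j yE] := prim_rootP prim_z (Fp_fermat y_neq0).
move/eqP: zy; rewrite yE -exprM (eq_prim_root_expr prim_z) => /eqP ij.
(* Exponents are known modulo [p - 1] only, which is even, so their parity is well defined. *)
have p1_even : (2 %| p - 1)%N by rewrite dvdn2 oddB // p_odd.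
have : (i = j * 2 %[mod 2])%N.
  by rewrite -(modn_dvdm i p1_even) ij modn_dvdm.
by rewrite modnMl modn2; case: odd.
Qed.

Lemma Fp_ratio_square (c c' : 'F_p) : c != 0 -> c' != 0 ->
  (c \in SQ p) = (c' \in SQ p) -> exists2 v, v != 0 & c' = v ^+ 2 * c.
Proof.
have [z prim_z] := Fp_prim_root.
have z_neq0 : z != 0.
  by rewrite (prim_root_eq0 prim_z) subn_eq0 -ltnNge prime_gt1.
move=> c_neq0 c'_neq0.
have [i ->] := prim_rootP prim_z (Fp_fermat c_neq0).
have [j ->] := prim_rootP prim_z (Fp_fermat c'_neq0).
(* The exponents have equal parity; the witness is [z] to half of [j - i], written without natural
   subtraction. *)
rewrite !SQ_exp // => ij; exists (z ^+ ((j + i)./2) * z ^- i).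
  by rewrite mulf_neq0 ?invr_eq0 ?expf_neq0.
rewrite exprMn -exprM muln2 even_halfK ?exprD; last first.
  by rewrite oddD -[odd i]negbK -[odd j]negbK ij addbb.
move: (z ^+ i) (expf_neq0 i z_neq0) => y y_neq0; field.
by [].
Qed.

Lemma SQ_scale (w j : 'F_p) : w != 0 -> (w ^+ 2 * j \in SQ p) = (j \in SQ p).
Proof.
move=> w_neq0; rewrite !inE mulf_eq0 expf_eq0 (negPf w_neq0) /=.
congr (_ && _); apply/existsP/existsP => -[y /eqP yE].
  by exists (w^-1 * y); rewrite exprMn -yE exprVn mulKf ?expf_neq0.
by exists (w * y); rewrite exprMn -yE.
Qed.

Lemma in_NSQ (c : 'F_p) : (c \in NSQ p) = (c != 0) && (c \notin SQ p).
Proof. by rewrite !inE; case: (c != 0). Qed.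

Definition square_class (c : 'F_p) : nat :=
  if c == 0 then 0%N else if c \in SQ p then 1%N else 2%N.

Lemma square_class_eq0 c : (square_class c == 0%N) = (c == 0).
Proof. by rewrite /square_class; case: (c == 0) => //; case: ifP. Qed.

Lemma fusion_square_class : fusion 3 square_class.
Proof.
split; last 1 first.
- move=> h c c' full cc'.
  have [v v_neq0 c'E] : exists2 v, v != 0 & c' = v ^+ 2 * c.
    have [c0 | c_neq0] := eqVneq c 0.
      have /eqP-> : c' == 0 by rewrite -square_class_eq0 -cc' c0 square_class_eq0.
      by exists 1; rewrite ?oner_neq0 // c0 mulr0.
    have c'_neq0 : c' != 0 by rewrite -square_class_eq0 -cc' square_class_eq0.
    apply: Fp_ratio_square => //; move: cc'.
    rewrite /square_class (negPf c_neq0) (negPf c'_neq0).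
    by case: (c \in _); case: (c' \in _).
  (* Squaring [v * w = w ^+ h] gives the required equation for [v ^+ 2] and [w ^+ 2], and scaling by
     the square [w ^+ 2] preserves square classes. *)
  have [w w_neq0 vwE] := full v v_neq0.
  exists (v ^+ 2), (w ^+ 2); split=> // [||j].
  - by rewrite expf_neq0.
  - by rewrite -exprMn vwE exprAC.
  - by rewrite /square_class SQ_scale // mulf_eq0 expf_eq0 (negPf w_neq0).
- by move=> c; rewrite /square_class; case: ifP => // _; case: ifP.
- have [z prim_z] := Fp_prim_root.
  have z_neq0 : z != 0.
    by rewrite (prim_root_eq0 prim_z) subn_eq0 -ltnNge prime_gt1.
  move=> [|[|[|//]]] _; rewrite /square_class.
  + by exists 0; rewrite eqxx.
  + by exists 1; rewrite oner_eq0 -(expr0 z) SQ_exp.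
  + by exists z; rewrite (negPf z_neq0) -[z]expr1 SQ_exp.
exact: square_class_eq0.
Qed.

Lemma fusion_nonzero : fusion 2 (fun c : 'F_p => (c != 0) : nat).
Proof.
split; last 1 first.
- move=> h c c' full cc'.
  have [t t_neq0 c'E] : exists2 t, t != 0 & c' = t * c.
    move: cc'; have [-> | c_neq0] := eqVneq c 0.
      case: (eqVneq c' 0) => [-> _|//].
      by exists 1; rewrite ?oner_neq0 // mulr0.
    case: (eqVneq c' 0) => // c'_neq0 _.
    by exists (c' / c); rewrite ?mulfVK // mulf_neq0 ?invr_eq0.
  have [u u_neq0 tuE] := full t t_neq0.
  exists t, u; split=> // j.
  by rewrite mulf_eq0 (negPf u_neq0).
- by move=> c; case: (c == 0).
- move=> [|[|//]] _; first by exists 0; rewrite eqxx.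
  by exists 1; rewrite oner_neq0.
by move=> c; case: (c == 0).
Qed.

(* [f* ] is homogeneous of degree [k + 1], where [k (h - 1) = 1] modulo
   [p - 1]. *)
Lemma DBF_dual_pair n (f : 'rV['F_p]_n -> 'F_p) U W :
    ~~ odd n -> DBF f -> Bplus f = vset U -> Bplus (dual f) = vset W ->
  exists h h' : nat, dual_pair f (dual f) U W h h'.
Proof.
move=> n_even [[f_bent g_bent] f0 [h [h_gt0 coprime_h f_hom]]] BU BW.
(* For [h = 1] the gcd would be [p - 1], which is larger than 1. *)
have h1_gt0 : (0 < h - 1)%N.
  by case: posnP coprime_h p_gt2 => // ->; rewrite gcd0n => ?; lia.
case: (egcdnP (p - 1) h1_gt0) => k l kE _; rewrite coprime_h in kE.
have rootE (t : 'F_p) : t != 0 -> t ^+ (k * (h - 1)) = t.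
  by move=> t_neq0; rewrite kE exprD mulnC exprM Fp_fermat // expr1n mul1r.
have p1_even : ~~ odd (p - 1) by rewrite oddB // p_odd.
(* Hence [k] and [h - 1] are both odd, so both degrees [h] and [k.+1] are even. *)
have : odd (k * (h - 1)) by rewrite kE oddD oddM (negPf p1_even) andbF.
rewrite oddM oddB // => /andP[k_odd h_even].
have h_full : full_degree p h.
  move=> t t_neq0; exists (t ^+ k); first by rewrite expf_neq0.
  by rewrite -[in RHS](subnK h_gt0) addn1 exprSr -exprM rootE.
have h'_full : full_degree p k.+1.
  move=> t t_neq0; exists (t ^+ (h - 1)); first by rewrite expf_neq0.
  by rewrite exprSr -exprM mulnC rootE.
have h_even' : ~~ odd h by move: h_even; case: odd.
have f_even x : f (- x) = f x by apply: homogeneousN f_hom _.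
exists h, k.+1; split=> //.
- by move=> a; rewrite walsh_dual // BU inE.
- move=> x; rewrite walsh_dual // BW inE.
  by rewrite -[x in dual _ x]opprK dual_dual // f_even.
- exact: dual_at0.
(* Here [dual_scale] is used with [b := t ^+ k], for which [t * b] is both [t ^+ k.+1] and
   [b ^+ h]. *)
- move=> t a t_neq0; rewrite exprS; apply: dual_scale f_hom => //.
    by rewrite expf_neq0.
  by rewrite -[in RHS](subnK h_gt0) addn1 exprSr -exprM rootE.
- by rewrite /= k_odd.
Qed.

End PrimeField.

(** * The partitions [U4] and [U5] *)

Lemma in_cset_bigcup p n (f : 'rV['F_p]_n -> 'F_p) (P : pred 'F_p) x :
  (x \in \bigcup_(i | P i) cset f i) = (x \in Bplus (dual f)) && P (f x).
Proof.
apply/bigcupP/andP => [[i Pi]|[xB Pfx]].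
  by rewrite inE => /andP[-> /eqP->].
by exists (f x); rewrite // inE xB eqxx.
Qed.

Lemma in_dset_bigcup p n (f : 'rV['F_p]_n -> 'F_p) (P : pred 'F_p) x :
  (x \in \bigcup_(i | P i) dset f i) = (x \in Bminus (dual f)) && P (f x).
Proof.
apply/bigcupP/andP => [[i Pi]|[xB Pfx]].
  by rewrite inE => /andP[-> /eqP->].
by exists (f x); rewrite // inE xB eqxx.
Qed.

Theorem proposition1 (p n r : nat) (p_prime : prime p) (p_odd : odd p)
    (n_ge4 : (4 <= n)%N) (n_even : ~~ odd n) (f : 'rV['F_p]_n -> 'F_p)
    (f_nwr : non_weakly_regular f) (f_DBF : DBF f)
    (Bf : nondegenerate_subspace r (Bplus f))
    (Bdf : nondegenerate_subspace r (Bplus (dual f)))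
    (r_bounds : (n %/ 2 + 1 <= r <= n - 1)%N) :
  [/\ tuple_partition (U4 f),
      @induces_symmetric_scheme p n 7 (U4 f),
      tuple_partition (U5 f)
    & @induces_symmetric_scheme p n 5 (U5 f)].
Proof.
have [U [BU dimU _]] := Bf; have [W [BW dimW _]] := Bdf.
have [h [h' fg]] := DBF_dual_pair p_prime p_odd n_even f_DBF BU BW.
have [[f_bent g_bent] _ _] := f_DBF.
have [r_gt r_lt] : (n./2 < r)%N /\ (r < n)%N.
  by move: r_bounds; rewrite divn2 => /andP[]; lia.
have orthE x : x \in orth_compl (vset U) -> x \in W /\ f x = 0.
  exact: orth_sub fg.
have BmW x : (x \in Bminus (dual f)) = (x \notin W).
  by rewrite Bminus_setC // BW !inE.
have BpW x : (x \in Bplus (dual f)) = (x \in W) by rewrite BW inE.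
(* These implications rule out the impossible truth values of the five tests on [x]; matching each
   listed block with its label is then a finite Boolean check. *)
have blocks x : [&& (x == 0) ==> (x \in orth_compl (vset U)),
    (x \in orth_compl (vset U)) ==> (x \in W) && (f x == 0)
    & (f x == 0) ==> (f x \notin SQ p)].
  apply/and3P; split; apply/implyP.
  - by move/eqP->; exact: orth0.
  - by move/orthE => [-> ->]; rewrite eqxx.
  - by move/eqP->; rewrite inE eqxx.
have scheme4 : @induces_symmetric_scheme p n 7 (U4 f).
  apply: (fusion_scheme p_prime p_odd n_even (fusion_square_class p_prime p_odd)
            fg dimU dimW r_gt r_lt) => // i.
  apply/setP => x; have := blocks x; rewrite [RHS]inE /label /square_class.
  rewrite (tnth_nth set0).
  case: i => -[|[|[|[|[|[|[|[|//]]]]]]]] _ /=;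
  rewrite ?in_cset_bigcup ?in_dset_bigcup ?in_setD ?in_set1 ?in_NSQ ?BU ?BpW ?BmW
    ?[x \in cset _ _]inE ?[x \in dset _ _]inE ?BpW ?BmW;
  case: (x == 0); case: (x \in orth_compl _); case: (x \in W);
  by case: (f x == 0); case: (f x \in SQ p).
have scheme5 : @induces_symmetric_scheme p n 5 (U5 f).
  apply: (fusion_scheme p_prime p_odd n_even (fusion_nonzero p) fg dimU dimW
            r_gt r_lt) => // i.
  apply/setP => x; have := blocks x; rewrite [RHS]inE /label.
  rewrite (tnth_nth set0); case: i => -[|[|[|[|[|[|//]]]]]] _ /=;
  rewrite ?in_cset_bigcup ?in_dset_bigcup ?in_setD ?in_set1 ?BU ?BpW ?BmW
    ?[x \in cset _ _]inE ?[x \in dset _ _]inE ?BpW ?BmW;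
  case: (x == 0); case: (x \in orth_compl _); case: (x \in W);
  by case: (f x == 0); case: (f x \in SQ p).
by split=> //; [case: scheme4 | case: scheme5].
Qed.
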